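(* Let $m\ge1$ be an integer, let $\tilde H\in\Omega_{2n}$ be invertible and Hermitian, and let $\tilde B\in\Omega_{2n}$ be $\tilde H$-selfadjoint with $\sigma(\tilde B)=\{0\}$. Then there exists an $\tilde H$-selfadjoint $\tilde A\in\Omega_{2n}$ with $\tilde A^m=\tilde B$ if and only if the following hold: 1. There is a reordering of the Segre characteristic of $\tilde B$ (at $0$, with zeros allowed as entries) into $m$-tuples such that each $m$-tuple occurs twice and any two numbers in the same $m$-tuple differ by at most one. 2. Using such a reordering, there exist an invertible $S\in\Omega_{2n}$, an integer $t$, integers $a_j\ge0$ and $0<r_j\le m$ ($j=1,\dots,t$) and signs $\varepsilon^{(j)}_i\in\{1,-1\}$ such that $S^{-1}\tilde BS=J_B\oplus J_B$ and $S^*\tilde HS=H_B\oplus H_B$ (up to permutation of blocks), where $$J_B=\bigoplus_{j=1}^t\Big(\bigoplus_{i=1}^{r_j}J_{a_j+1}(0)\oplus\bigoplus_{i=r_j+1}^{m}J_{a_j}(0)\Big),\quad H_B=\bigoplus_{j=1}^t\Big(\bigoplus_{i=1}^{r_j}\varepsilon^{(j)}_iQ_{a_j+1}\oplus\bigoplus_{i=r_j+1}^{m}\varepsilon^{(j)}_iQ_{a_j}\Big),$$ and for each $j$ there is $\eta_j\in\{1,-1\}$ such that: among $\varepsilon^{(j)}_1,\dots,\varepsilon^{(j)}_{r_j}$, if $r_j$ is even then half equal $\eta_j$ and half equal $-\eta_j$, and if $r_j$ is odd then exactly one more equals $\eta_j$ than equals $-\eta_j$; the same rule (with the same $\eta_j$)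 holds for $\varepsilon^{(j)}_{r_j+1},\dots,\varepsilon^{(j)}_m$ with $m-r_j$ in place of $r_j$.
   Context: $\Omega_{2n}=\{\begin{bmatrix}A_1&\bar A_2\\-A_2&\bar A_1\end{bmatrix}: A_1,A_2\in\mathbb{C}^{n\times n}\}\subset\mathbb{C}^{2n\times 2n}$. $J_k(0)$: $k\times k$ nilpotent Jordan block; $Q_k$: $k\times k$ matrix with ones on the anti-diagonal and zeros elsewhere; $J_0(0)$ and $Q_0$ denote empty (absent) blocks. If the Jordan blocks of a matrix at $0$ are $J_{n_1}(0),\dots,J_{n_r}(0)$ with $n_1\ge\dots\ge n_r>0$, its Segre characteristic (at $0$) is $n_1,\dots,n_r,0,0,\dots$. For invertible Hermitian $H$, $A$ is $H$-selfadjoint if $HA=A^*H$. *)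

(* Defs.v *)
(* Complex numbers: C := R[i] for an arbitrary R : realType
   (every realType is a model of the real numbers, so R[i] is a model of C). *)
From HB Require Import structures.
From mathcomp Require Import all_boot all_order all_algebra.
From mathcomp.real_closed Require Export complex.
From mathcomp Require Import reals.
Set Implicit Arguments. Unset Strict Implicit. Unset Printing Implicit Defensive.
Import Order.TTheory GRing.Theory Num.Theory.
Local Open Scope ring_scope.

Section Defs.
Variable R : realType.
Local Notation C := R[i].

Definition cconjmx m n (A : 'M[C]_(m, n)) : 'M[C]_(m, n) := map_mx (@conjc R) A.
Definition cadjmx m n (A : 'M[C]_(m, n)) : 'M[C]_(n, m) := (cconjmx A)^T.

Definition inOmega n (A : 'M[C]_(n + n)) : Prop :=
  exists A1 A2 : 'M[C]_n, A = block_mx A1 (cconjmx A2) (- A2) (cconjmx A1).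

Definition is_hermitian N (H : 'M[C]_N) : Prop := cadjmx H = H.

Definition H_selfadjoint N (H A : 'M[C]_N) : Prop := H *m A = cadjmx A *m H.

Definition spectrum_is_zero N (B : 'M[C]_N) : Prop :=
  forall l : C, eigenvalue B l <-> l = 0.

Definition jordan0 k : 'M[C]_k := \matrix_(i < k, j < k) ((i.+1 == j :> nat)%:R).
Definition antidiag k : 'M[C]_k := \matrix_(i < k, j < k) ((i + j == k.-1)%N%:R).

Definition bsize (L : seq (nat * C)) (i : 'I_(size L)) : nat := (nth (0%N, 0) L i).1.
Definition bsign (L : seq (nat * C)) (i : 'I_(size L)) : C := (nth (0%N, 0) L i).2.
Arguments bsize : clear implicits.
Arguments bsign : clear implicits.

(* (+)_i J_{k_i}(0)  and  (+)_i eps_i Q_{k_i} (blocks of size 0 are absent) *)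
Definition blkJ (L : seq (nat * C)) : 'M[C]_(\sum_(i < size L) bsize L i) :=
  \mxdiag_(i < size L) jordan0 (bsize L i).
Definition blkQ (L : seq (nat * C)) : 'M[C]_(\sum_(i < size L) bsize L i) :=
  \mxdiag_(i < size L) (bsign L i *: antidiag (bsize L i)).

Definition unsigned (s : seq nat) : seq (nat * C) := [seq (x, (0 : C)) | x <- s].

(* Segre characteristic at 0: s is the list of sizes of the Jordan blocks of B
   at eigenvalue 0, i.e. B is similar to (+)_i J_{s_i}(0) (+) Cr with
   0 not an eigenvalue of Cr. *)
Definition segre0 N (B : 'M[C]_N) (s : seq nat) : Prop :=
  all (fun k => 0 < k)%N s /\
  exists (k : nat) (Cr : 'M[C]_k) (P : 'M[C]_N)
         (e : ((\sum_(i < size (unsigned s))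
                  bsize (unsigned s) i) + k)%N = N),
    ~ eigenvalue Cr 0 /\ P \in unitmx /\
    invmx P *m B *m P = castmx (e, e) (block_mx (blkJ (unsigned s)) 0 0 Cr).

Definition cond1 N (m : nat) (B : 'M[C]_N) : Prop :=
  exists s : seq nat, segre0 B s /\
  exists T : seq (seq nat),
    all (fun u => size u == m) T /\
    all (fun u => all (fun x => all (fun y => (x <= y.+1)%N) u) u) T /\
    perm_eq s [seq x <- flatten (T ++ T) | (0 < x)%N].

Definition blocks_B (m t : nat) (a r : nat -> nat) (eps : nat -> nat -> C) :
  seq (nat * C) :=
  flatten [seq [seq ((if (i < r j)%N then (a j).+1 else a j), eps j i) | i <- iota 0 m]
          | j <- iota 0 t].

Definition balanced (eta : C) (l : seq C) : Prop :=
  let p := count (fun e => e == eta) l in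
  let q := count (fun e => e == - eta) l in
  (~~ odd (size l) -> p = q) /\ (odd (size l) -> p = q.+1).

Definition cond2 n (m : nat) (H B : 'M[C]_(n + n)) : Prop :=
  exists (S : 'M[C]_(n + n)) (t : nat) (a r : nat -> nat) (eps : nat -> nat -> C),
    inOmega S /\ S \in unitmx /\
    (forall j, (j < t)%N -> (0 < r j <= m)%N) /\
    (forall j i, (j < t)%N -> (i < m)%N -> eps j i = 1 \/ eps j i = -1) /\
    (forall j, (j < t)%N -> exists eta : C, (eta = 1 \/ eta = -1) /\
        balanced eta [seq eps j i | i <- iota 0 (r j)] /\
        balanced eta [seq eps j i | i <- iota (r j) (m - r j)]) /\
    exists L : seq (nat * C),
      perm_eq L (blocks_B m t a r eps ++ blocks_B m t a r eps) /\
      exists e : (\sum_(i < size L) bsize L i)%N = (n + n)%N,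
        invmx S *m B *m S = castmx (e, e) (blkJ L) /\
        cadjmx S *m H *m S = castmx (e, e) (blkQ L).

End Defs.

(* Main.v *)
(* [Omega_(2n)] consists of the matrices commuting with the conjugate-linear map
   [j : v |-> K v^conj], [j^2 = -1], so everything is about a quaternionic space
   with a Hermitian form [h(u, v) = u^* H v].

   Chains. A nilpotent selfadjoint [A] in [Omega] has generators [x_i] such that
   [h(x_i, A^q x_l) = eps_i] if [i = l] and [q = k_i - 1], and [0] otherwise,
   [h(x_i, A^q j x_l) = 0], and the [A^q x_i], [j A^q x_i] form a basis: the
   generators are found one at a time in the orthogonal complement of the
   previous ones, by polarization of [h(u, A^(k-1) u)] for the largest possible
   [k], followed by removing the lower moments [h(x, A^q x)].

   Roots. If [x] generates a chain of length [a m + r] of [A], then the vectors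
   [A^i x], [i < m], generate chains of [B = A^m], of length [a + 1] for [i < r]
   and [a] for [i >= r], and the form pairs the class [i] with the class [r-1-i]
   (resp. [m+r-1-i]). Diagonalizing each pair gives one sign [+] and one sign [-],
   and a class paired with itself keeps the sign of [x]: this is the balance
   condition. Conversely, balanced signs can be re-paired, and interleaving the
   [m] chains of [B] gives a chain of a root [A].

   A similarity in [Omega] that brings [B] and [H] to a block-diagonal form has
   two equal halves of blocks exchanged by [j], so it yields such generators. *)
Require Import Defs.
From HB Require Import structures.
From mathcomp Require Import all_boot all_order all_algebra.
From mathcomp.real_closed Require Import complex.
From mathcomp Require Import reals zify ring.
From mathcomp Require boolp.
Import Order.TTheory GRing.Theory Num.Theory.
Local Open Scope ring_scope.
Set Implicit Arguments. Unset Strict Implicit. Unset Printing Implicit Defensive.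

(** * Positions in a block-diagonal layout *)

(* [loc s p] is the pair (index of the block, offset inside the block) of the
   position [p] when blocks of sizes [s] are laid out consecutively; it is
   meaningful only for [p < sumn s]. *)
Fixpoint loc (s : seq nat) (p : nat) : nat * nat :=
  if s is k :: s' then
    if (p < k)%N then (0%N, p)
    else ((loc s' (p - k)).1.+1, (loc s' (p - k)).2)
  else (0%N, p).

Definition start (s : seq nat) (i : nat) : nat := sumn (take i s).

Lemma loc1_lt s p : (p < sumn s)%N -> ((loc s p).1 < size s)%N.
Proof.
elim: s p => [|k s IH] p //= hp; case: (ltnP p k) => // hk /=.
by rewrite ltnS; apply: IH; lia.
Qed.

Lemma loc2_lt s p : (p < sumn s)%N -> ((loc s p).2 < nth 0%N s (loc s p).1)%N.
Proof.
elim: s p => [|k s IH] p //= hp; case: (ltnP p k) => // hk /=.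
by apply: IH; lia.
Qed.

Lemma start_loc s p : (p < sumn s)%N -> (start s (loc s p).1 + (loc s p).2)%N = p.
Proof.
rewrite /start; elim: s p => [|k s IH] p //= hp; case: (ltnP p k) => hk //=.
have := IH (p - k)%N; lia.
Qed.

Lemma loc_start s i l :
  (i < size s)%N -> (l < nth 0%N s i)%N -> loc s (start s i + l) = (i, l).
Proof.
rewrite /start; elim: s i => [|k s IH] [|i] //= hi hl; first by rewrite hl.
rewrite -addnA ltnNge leq_addr /= addKn.
by rewrite (IH i hi hl).
Qed.

Lemma start_lt s i l :
  (i < size s)%N -> (l < nth 0%N s i)%N -> (start s i + l < sumn s)%N.
Proof.
rewrite /start; elim: s i => [|k s IH] [|i] //= hi hl; first by lia.
have := IH i hi hl; lia.
Qed.

Lemma loc_cat s1 s2 p : loc (s1 ++ s2) p =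
  if (p < sumn s1)%N then loc s1 p
  else ((size s1 + (loc s2 (p - sumn s1)).1)%N, (loc s2 (p - sumn s1)).2).
Proof.
elim: s1 p => [|k s IH] p /=; first by rewrite subn0; case: (loc s2 p).
case: (ltnP p k) => hk; first by rewrite ifT //; lia.
rewrite IH.
have -> : (p - k < sumn s)%N = (p < k + sumn s)%N by lia.
by case: ifP => // _ /=; rewrite subnDA addSn.
Qed.

Definition same (s : seq nat) (p q : nat) : bool := (loc s p).1 == (loc s q).1.

Lemma same_cat s1 s2 p q : (p < sumn (s1 ++ s2))%N -> (q < sumn (s1 ++ s2))%N ->
  same (s1 ++ s2) p q =
  if (p < sumn s1)%N then (q < sumn s1)%N && same s1 p q
  else (sumn s1 <= q)%N && same s2 (p - sumn s1) (q - sumn s1).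
Proof.
move=> hp hq; rewrite /same !loc_cat.
case: ifP => h1; case: (ltnP q) => h2 //=.
- by have := loc1_lt h1; lia.
- by have := loc1_lt h2; lia.
- by rewrite eqn_add2l.
Qed.

(** Empty blocks cover no position, so deleting them only renumbers the blocks. *)
Lemma same_filter s p q :
  same [seq x <- s | (0 < x)%N] p q = same s p q.
Proof.
rewrite /same; elim: s p q => [|k s IH] p q //=.
case: k => [|k] /=; first by rewrite !subn0 IH eqSS.
by case: ifP; case: ifP => //= h1 h2; rewrite !eqSS IH.
Qed.

Lemma nth_unzip1 (T : Type) (c : T) (L : seq (nat * T)) i :
  nth 0%N (unzip1 L) i = (nth (0%N, c) L i).1.
Proof. by elim: L i => [|x L IH] [|i] //=. Qed.

Lemma loc_pred s q : (q < sumn s)%N -> (0 < (loc s q).2)%N ->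
  (0 < q)%N /\ loc s q.-1 = ((loc s q).1, (loc s q).2.-1).
Proof.
move=> hq h; have := start_loc hq; have := loc1_lt hq; have := loc2_lt hq.
set i := (loc s q).1; set l := (loc s q).2 => hl hi e.
rewrite -/l in h; split; first by lia.
by rewrite -(loc_start hi (l := l.-1)); [congr loc; lia | lia].
Qed.

(** * Jordan and sign matrices read off a list of sized, signed blocks *)

Section BlockMatrices.
Variable R : realType.
Local Notation C := R[i].
Local Notation bsz L := (@bsize R L).
Implicit Types L : seq (nat * C).

Definition total_size L : nat := sumn (unzip1 L).

Lemma total_size_cat L1 L2 : total_size (L1 ++ L2) = (total_size L1 + total_size L2)%N.
Proof. by rewrite /total_size /unzip1 map_cat sumn_cat. Qed.

(** Entries are functions of natural numbers and the matrix size is a free parameter, so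
    concatenating or filtering [L] involves no dependent indices. *)
Definition Jent L (p q : nat) : C := (same (unzip1 L) p q && (p.+1 == q))%:R.
Definition Qent L (p q : nat) : C :=
  let: c := loc (unzip1 L) p in let: d := loc (unzip1 L) q in
  if (c.1 == d.1) && ((c.2 + d.2).+1 == (nth (0%N, 0) L c.1).1)
  then (nth (0%N, 0) L c.1).2 else 0.

Definition Jmx L s : 'M[C]_s := \matrix_(p, q) Jent L p q.
Definition Qmx L s : 'M[C]_s := \matrix_(p, q) Qent L p q.

Lemma big_bsize L i : (i <= size L)%N ->
  (\sum_(k < size L | (k < i)%N) bsz L k)%N = start (unzip1 L) i.
Proof.
move=> hi.
rewrite (big_ord_narrow hi) /=.
rewrite /start sumnE (big_nth 0%N) size_takel ?size_map // big_mkord.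
by apply: eq_bigr => k _; rewrite nth_take // (nth_unzip1 (0 : C)).
Qed.

Lemma big_bsize_all L : (\sum_(k < size L) bsz L k)%N = total_size L.
Proof.
have := big_bsize (leqnn (size L)); rewrite /start take_oversize ?size_map // -/(total_size
    L) => <-.
by apply: eq_bigl => k; rewrite ltn_ord.
Qed.

(** Translates the dependent indexing of [\mxdiag] into [loc]; [blkJ_cast] and [blkQ_cast] then
    remove it for good. *)
Lemma loc_tagnat L (p : 'I_(\sum_(k < size L) bsz L k)) :
  loc (unzip1 L) p = (tagnat.sig1 p : nat, tagnat.sig2 p : nat).
Proof.
rewrite -{1}(tagnat.sig2K p) tagnat.RankEsum big_bsize; last exact: ltnW.
rewrite loc_start ?size_map //.
by rewrite (nth_unzip1 (0 : C)); exact: (ltn_ord (tagnat.sig2 p)).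
Qed.

Lemma mxdiag_entries L (Bf : forall i, 'M[C]_(bsz L i))
    (F : nat -> nat -> nat -> C) (p q : 'I_(\sum_(k < size L) bsz L k)) :
  (forall i (l l' : 'I_(bsz L i)), Bf i l l' = F i l l') ->
  (\mxdiag_i Bf i) p q =
  if tagnat.sig1 p == tagnat.sig1 q
  then F (tagnat.sig1 p) (tagnat.sig2 p) (tagnat.sig2 q) else 0.
Proof.
move=> hB; rewrite !mxE.
move: (tagnat.sig1 p) (tagnat.sig1 q) (tagnat.sig2 p) (tagnat.sig2 q) => i j l l'.
case: eqP => [e | _]; last by rewrite mxE.
by subst j; rewrite conform_mx_id hB.
Qed.

Lemma blkJ_cast L N (e : (\sum_(i < size L) bsz L i)%N = N) :
  castmx (e, e) (blkJ L) = Jmx L N.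
Proof.
subst N; rewrite castmx_id; apply/matrixP => p q.
rewrite (mxdiag_entries (F := fun _ l l' => (l.+1 == l')%:R));
  last by move=> i l l'; rewrite mxE.
rewrite mxE /Jent /same !loc_tagnat /=.
case: eqP => [e1 | ne]; last first.
  by rewrite (_ : (_ == _) = false) //; apply/eqP => h; apply: ne; apply: val_inj.
have e1n : tagnat.sig1 p = tagnat.sig1 q :> nat := congr1 val e1.
rewrite e1n eqxx /=; congr (_ %:R); congr nat_of_bool.
have hp : (p < total_size L)%N by rewrite -[X in (_ < X)%N]big_bsize_all.
have hq : (q < total_size L)%N by rewrite -[X in (_ < X)%N]big_bsize_all.
have := start_loc hp; have := start_loc hq; rewrite !loc_tagnat /= e1n.
by move=> h1 h2; rewrite -[in RHS]h1 -[in RHS]h2 -addnS eqn_add2l.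
Qed.

Lemma blkQ_cast L N (e : (\sum_(i < size L) bsz L i)%N = N) :
  castmx (e, e) (blkQ L) = Qmx L N.
Proof.
subst N; rewrite castmx_id; apply/matrixP => p q.
rewrite (mxdiag_entries (F := fun i l l' =>
   (nth (0%N, 0) L i).2 * (l + l' == (nth (0%N, 0%R) L i).1.-1)%N%:R));
  last by move=> i l l'; rewrite !mxE.
rewrite mxE /Qent !loc_tagnat /=.
case: eqP => [e1 | ne]; last first.
  by rewrite (_ : (_ == _) = false) //; apply/eqP => h; apply: ne; apply: val_inj.
have e1n : tagnat.sig1 p = tagnat.sig1 q :> nat := congr1 val e1.
rewrite e1n eqxx /=.
(* The offset is below the block size, so the size is positive and the truncated predecessor in
   [antidiag] is a true one. *)
have : (tagnat.sig2 p < (nth (0%N, 0%R) L (tagnat.sig1 q)).1)%N.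
  by rewrite -e1n; exact: (ltn_ord (tagnat.sig2 p)).
case: (nth _ _ _) => [[|k] c] //= _; rewrite eqSS.
by case: ifP; rewrite ?mulr1 ?mulr0.
Qed.

Lemma Jent_cat L1 L2 p q : (p < total_size (L1 ++ L2))%N -> (q < total_size (L1 ++ L2))%N ->
  Jent (L1 ++ L2) p q =
  if (p < total_size L1)%N then (if (q < total_size L1)%N then Jent L1 p q else 0)
  else if (total_size L1 <= q)%N then Jent L2 (p - total_size L1) (q - total_size L1) else 0.
Proof.
move=> hp hq; rewrite /Jent /total_size /unzip1 map_cat same_cat -?map_cat //.
case: ifP => h1; case: ifP => h2 //=; congr ((_ && _)%:R); lia.
Qed.

Lemma Qent_cat L1 L2 p q : (p < total_size (L1 ++ L2))%N -> (q < total_size (L1 ++ L2))%N ->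
  Qent (L1 ++ L2) p q =
  if (p < total_size L1)%N then (if (q < total_size L1)%N then Qent L1 p q else 0)
  else if (total_size L1 <= q)%N then Qent L2 (p - total_size L1) (q - total_size L1) else 0.
Proof.
rewrite !total_size_cat => hp hq; rewrite /Qent [unzip1 (_ ++ _)]map_cat !loc_cat -!/(unzip1
    _) -!/(total_size _).
have hs (x : nat) : (x < total_size L1)%N -> ((loc (unzip1 L1) x).1 < size L1)%N.
  by move=> /loc1_lt; rewrite size_map.
case: (ltnP p (total_size L1)) => h1; case: (ltnP q (total_size L1)) => h2 //=.
- by rewrite nth_cat hs.
- rewrite (_ : (_ == _) = false) //.
  by have := hs _ h1; rewrite size_map; lia.
- rewrite (_ : (_ == _) = false) //.
  by have := hs _ h2; rewrite size_map; lia.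
- by rewrite eqn_add2l size_map nth_cat ltnNge leq_addr /= addKn.
Qed.

Lemma Jmx_cat L1 L2 n1 n2 : total_size L1 = n1 -> total_size L2 = n2 ->
  Jmx (L1 ++ L2) (n1 + n2) = block_mx (Jmx L1 n1) 0 0 (Jmx L2 n2).
Proof.
move=> <- <-.
rewrite -[LHS]submxK; congr block_mx; apply/matrixP => p q;
  have hp := ltn_ord p; have hq := ltn_ord q;
  rewrite !mxE /= Jent_cat ?total_size_cat; try lia.
- by rewrite hp hq.
- by rewrite hp ltnNge leq_addr.
- by rewrite ltnNge leq_addr /= ifF //; lia.
- by rewrite ltnNge !leq_addr /= !addKn.
Qed.

Lemma Qmx_cat L1 L2 n1 n2 : total_size L1 = n1 -> total_size L2 = n2 ->
  Qmx (L1 ++ L2) (n1 + n2) = block_mx (Qmx L1 n1) 0 0 (Qmx L2 n2).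
Proof.
move=> <- <-.
rewrite -[LHS]submxK; congr block_mx; apply/matrixP => p q;
  have hp := ltn_ord p; have hq := ltn_ord q;
  rewrite !mxE /= Qent_cat ?total_size_cat; try lia.
- by rewrite hp hq.
- by rewrite hp ltnNge leq_addr.
- by rewrite ltnNge leq_addr /= ifF //; lia.
- by rewrite ltnNge !leq_addr /= !addKn.
Qed.

Lemma Jmx_filter L N : Jmx [seq c <- L | (0 < c.1)%N] N = Jmx L N.
Proof.
apply/matrixP => p q; rewrite !mxE /Jent.
have -> : unzip1 [seq c <- L | (0 < c.1)%N] = [seq x <- unzip1 L | (0 < x)%N].
  by rewrite /unzip1 filter_map.
by rewrite same_filter.
Qed.

Lemma total_size_filter L : total_size [seq c <- L | (0 < c.1)%N] = total_size L.
Proof. by rewrite /total_size; elim: L => [|[[|k] c] L IH] //=; rewrite IH. Qed.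

Lemma Qent_filter L p q : Qent [seq c <- L | (0 < c.1)%N] p q = Qent L p q.
Proof.
elim: L p q => [|[[|k] c] L IH] p q //=.
  by rewrite IH /Qent /= !subn0 eqSS.
have {IH} := IH (p - k.+1)%N (q - k.+1)%N; rewrite /Qent /= => IH.
by case: (ltnP p k.+1) => _; case: (ltnP q k.+1) => _ //=; rewrite eqSS.
Qed.

Lemma Qmx_filter L N : Qmx [seq c <- L | (0 < c.1)%N] N = Qmx L N.
Proof. by apply/matrixP => p q; rewrite !mxE Qent_filter. Qed.

(** In the branch where [insubd] occurs its argument is in range, so its default value is not
    reached. *)
Lemma mulmx_Jmx L N (M : nat) (X : 'M[C]_(M, N)) a (q : 'I_N) : total_size L = N ->
  (X *m Jmx L N) a q =
  if (0 < (loc (unzip1 L) q).2)%N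
  then X a (insubd q (q : nat).-1) else 0.
Proof.
move=> e; subst N; rewrite mxE; case: ifP => h.
  have hq := ltn_ord q; have [q0 hl] := loc_pred hq h.
  have hv : insubd q (q : nat).-1 = q.-1 :> nat by rewrite val_insubd ifT //; lia.
  move: (insubd _ _) hv => q' hv.
  rewrite (bigD1 q') //= big1 ?addr0.
    by rewrite mxE /Jent /same hv hl /= eqxx prednK // eqxx mulr1.
  move=> p np; rewrite mxE /Jent.
  case: eqP => [e|]; last by rewrite andbF mulr0.
  by case/eqP: np; apply: val_inj; rewrite /= hv -e.
apply: big1 => p _; rewrite mxE /Jent.
case: (boolP (_ && _)) => //=; last by rewrite mulr0.
case/andP => /eqP e1 /eqP e2; move: h.
have := start_loc (ltn_ord q); have := start_loc (ltn_ord p); rewrite e1; lia.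
Qed.

Lemma Qmx_tr L N : (Qmx L N)^T = Qmx L N.
Proof.
apply/matrixP => p q; rewrite !mxE /Qent eq_sym.
by case: eqP => //= ->; rewrite addnC.
Qed.

(** On one block of size [k], the product of [Q_k] and [J_k(0)] has its ones where the offsets add
    up to [k], a symmetric condition. This is what makes the Jordan matrix selfadjoint for [Qmx]. *)
Lemma QmxJmx_sym L N : total_size L = N -> (Qmx L N *m Jmx L N)^T = Qmx L N *m Jmx L N.
Proof.
move=> e; subst N.
have key (p q : 'I_(total_size L)) : (Qmx L (total_size L) *m Jmx L (total_size L)) p q =
    let: c := loc (unzip1 L) p in let: d := loc (unzip1 L) q in
    if (c.1 == d.1) && (c.2 + d.2 == (nth (0%N, 0%R) L c.1).1)%N
    then (nth (0%N, 0) L c.1).2 else 0.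
  rewrite mulmx_Jmx //; have hq := ltn_ord q.
  case: ifP => h.
    have [q0 hl] := loc_pred hq h.
    have hv : insubd q (q : nat).-1 = q.-1 :> nat by rewrite val_insubd ifT //; lia.
    move: (insubd _ _) hv => q' hv.
    rewrite mxE /Qent hv hl /=.
    by rewrite -addnS prednK.
  rewrite (_ : (loc _ q).2 = 0)%N; last by lia.
  case: ifP => // /andP[/eqP e1 /eqP e2].
  by have := loc2_lt (ltn_ord p); rewrite (nth_unzip1 (0 : C)) -e2; lia.
apply/matrixP => p q; rewrite mxE !key eq_sym.
by case: eqP => //= ->; rewrite addnC.
Qed.

(** Row [p] has a single nonzero entry, at the mirror position [p'] of [p] in its block. *)
Lemma Qmx_sqr L N : total_size L = N ->
  (forall i, (i < size L)%N -> (nth (0%N, 0) L i).2 ^+ 2 = 1) ->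
  Qmx L N *m Qmx L N = 1%:M.
Proof.
move=> e hL; subst N; apply/matrixP => p q; rewrite !mxE.
have hp := ltn_ord p; have hi := loc1_lt hp; have hl := loc2_lt hp.
set i := (loc (unzip1 L) p).1 in hi hl; set l := (loc (unzip1 L) p).2 in hl.
set k := nth 0%N (unzip1 L) i in hl.
have hl' : (k - l.+1 < k)%N by lia.
have hb := start_lt hi hl'.
pose p' : 'I_(total_size L) := Ordinal hb.
have hp' : loc (unzip1 L) p' = (i, (k - l.+1)%N) by apply: loc_start.
have hk : (nth (0%N, 0) L i).1 = k by rewrite /k (nth_unzip1 (0 : C)).
rewrite (bigD1 p') //= big1 ?addr0.
  rewrite !mxE /Qent hp' /= -/i -/l eqxx hk /=.
  rewrite ifT; last by lia.
  case: (eqVneq p q) => [<- | ne] /=.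
    by rewrite -/i -/l eqxx ifT -?expr2 ?hL //=; [rewrite size_map in hi | lia].
  case: ifP => [/andP[/eqP e1 /eqP e2] | _]; last by rewrite mulr0.
  case/eqP: ne; apply: val_inj => /=.
  rewrite -(start_loc hp) -(start_loc (ltn_ord q)) -e1 -/i -/l; lia.
move=> r nr; rewrite !mxE /Qent -/i -/l hk.
case: ifP => [/andP[/eqP e1 /eqP e2] | _]; last by rewrite mul0r.
case/eqP: nr; apply: val_inj => /=.
rewrite -(start_loc (ltn_ord r)) -e1; lia.
Qed.

(* A block boundary at [N] is visible in the matrix as a zero entry just above
   the diagonal. *)
Lemma pos_split L N : all (fun c => 0 < c.1)%N L -> (N <= total_size L)%N ->
  (forall N', N = N'.+1 -> (N < total_size L)%N -> Jent L N' N = 0) ->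
  exists L1 L2, L = L1 ++ L2 /\ total_size L1 = N.
Proof.
elim: L N => [|c L IH] N; first by move=> _; rewrite leqn0 => /eqP -> _; exists [::], [::].
case: c => k c /= /andP[k0 hL] hN hJ.
case: N hN hJ => [|N] hN hJ; first by exists [::], ((k, c) :: L).
case: (ltnP N.+1 k) => hk.
  have := hJ N erefl; rewrite /total_size /= => h; have {h} := h ltac:(lia).
  rewrite /Jent /same /= hk (ltnW hk) !eqxx /= => /eqP.
  by rewrite oner_eq0.
have [|N' e h|L1 [L2 [e1 e2]]] := IH (N.+1 - k)%N hL.
- by move: hN; rewrite /total_size /=; lia.
- have := hJ N erefl; rewrite /total_size /= => h1.
  have {h1} := h1 ltac:(move: h; rewrite /total_size; lia).
  rewrite /Jent /same /=.
  have -> : (N < k)%N = false by lia.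
  have -> : (N.+1 < k)%N = false by lia.
  by rewrite /= eqSS -e eqxx (_ : N - k = N')%N ?eqxx //; lia.
by exists ((k, c) :: L1), L2; rewrite e1 /total_size /= -/(total_size L1) e2; split => //; lia.
Qed.

(** Peels off the first block: its size [k] is where the superdiagonal of ones first breaks, its
    sign the entry of [Qent] at row 0 and column [k - 1]. *)
Lemma pos_inj L1 L2 : all (fun c => 0 < c.1)%N L1 -> all (fun c => 0 < c.1)%N L2 ->
  total_size L1 = total_size L2 ->
  (forall p q, (p < total_size L1)%N -> (q < total_size L1)%N ->
     Jent L1 p q = Jent L2 p q /\ Qent L1 p q = Qent L2 p q) ->
  L1 = L2.
Proof.
elim: L1 L2 => [|[k c] L1 IH] [|[k' c'] L2] //=.
- by move=> _ /andP[h _]; rewrite /total_size /=; lia.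
- by move=> /andP[h _]; rewrite /total_size /=; lia.
move=> /andP[k0 h1] /andP[k'0 h2]; rewrite /total_size /= -/(total_size L1) -/(total_size L2)
    => es hJQ.
have ek : k = k'.
  case: (ltngtP k k') => // hk; exfalso.
  - have [||+ _] := hJQ k.-1 k; [lia | lia |].
    rewrite /Jent /same /= ltnn hk prednK // leqnn.
    rewrite (ltnW hk).
    by rewrite !eqxx /= => /esym/eqP; rewrite oner_eq0.
  - have [||+ _] := hJQ k'.-1 k'; [lia | lia |].
    rewrite /Jent /same /= ltnn hk prednK // leqnn.
    rewrite (ltnW hk).
    by rewrite !eqxx /= => /eqP; rewrite oner_eq0.
subst k'.
have ec : c = c'.
  have [||_] := hJQ 0%N k.-1; [lia | lia |].
  by rewrite /Qent /= k0 prednK // leqnn /= add0n prednK // eqxx.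
subst c'; congr (_ :: _); apply: IH => //; first by lia.
move=> p q hp hq; have [||] := hJQ (k + p)%N (k + q)%N; [lia | lia |].
rewrite /Jent /same /Qent /= !ltnNge !leq_addr /= !addKn !eqSS.
by rewrite -addnS eqn_add2l.
Qed.

End BlockMatrices.

(** * Block lists with signs 1 and -1 *)

Section Mixing.
Variable R : realType.
Local Notation C := R[i].
Implicit Types L : seq (nat * C).

Definition block_size L i : nat := (nth (0%N, 0 : C) L i).1.
Definition block_sign L i : C := (nth (0%N, 0 : C) L i).2.

Lemma loc_block_size L p : (p < total_size L)%N ->
  ((loc (unzip1 L) p).1 < size L)%N /\ ((loc (unzip1 L) p).2 < block_size L (loc (unzip1 L)
      p).1)%N.
Proof.
move=> hp; have := loc1_lt hp; have := loc2_lt hp.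
by rewrite size_map (nth_unzip1 (0 : C)).
Qed.

Lemma loc_start_block L i l : (i < size L)%N -> (l < block_size L i)%N ->
  (start (unzip1 L) i + l < total_size L)%N /\ loc (unzip1 L) (start (unzip1 L) i + l) = (i, l).
Proof.
move=> hi hl; split; [apply: start_lt | apply: loc_start];
  by rewrite ?size_map ?(nth_unzip1 (0 : C)).
Qed.

Definition signs L := forall i, (i < size L)%N -> block_sign L i = 1 \/ block_sign L i = -1.

Lemma signs_sqr L : signs L -> forall i, (i < size L)%N -> (nth (0%N, 0) L i).2 ^+ 2 = 1.
Proof. by move=> hL i /hL [] h; rewrite -/(block_sign L i) h ?sqrrN expr1n. Qed.

Lemma signs_conj L s : total_size L = s -> signs L -> cconjmx (Qmx L s) = Qmx L s.
Proof.
move=> e hL; subst s; apply/matrixP => p q; rewrite !mxE /Qent.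
case: ifP => _; last by rewrite conjc0.
have [h _] := loc_block_size (ltn_ord p).
by have [] := hL _ h; rewrite /block_sign => ->; rewrite ?rmorphN rmorph1.
Qed.

Lemma Jmx_conj L s : cconjmx (Jmx L s) = Jmx L s.
Proof. by apply/matrixP => p q; rewrite !mxE /Jent conjc_nat. Qed.

(** * Splitting and pairing the residue classes *)

(* Among the exponents [l < a m + r], the reflection [l -> a m + r - 1 - l]
   exchanges the residue classes of [i] and [mate m r i] modulo [m]. *)
Definition mate (m r i : nat) : nat :=
  if (i < r)%N then (r.-1 - i)%N else (m + r.-1 - i)%N.

Lemma mate_lt m r i : (0 < r <= m)%N -> (i < m)%N -> (mate m r i < m)%N.
Proof. by rewrite /mate => hr hi; case: ifP => h; lia. Qed.

Lemma mate_class m r i : (0 < r <= m)%N -> (i < m)%N -> (mate m r i < r)%N = (i < r)%N.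
Proof. by rewrite /mate => hr hi; case: ifP => h; lia. Qed.

Lemma mateK m r i : (0 < r <= m)%N -> (i < m)%N -> mate m r (mate m r i) = i.
Proof.
move=> hr hi; rewrite {1}/mate mate_class // /mate; case: (ltnP i r) => h; lia.
Qed.

(** Length of the chain of [A^m] that the residue class [i] spans inside a chain of [A] of length
    [a m + r]. *)
Definition power_size (a r : nat) (i : nat) : nat := if (i < r)%N then a.+1 else a.

(** The left side is the condition for [h(A^i x, B^q A^i' x)] to be nonzero when [B = A^m] and [x]
    generates a chain of length [a m + r]. *)
Lemma mate_arith m a r q i i' : (0 < r <= m)%N -> (i < m)%N -> (i' < m)%N ->
  ((i + (q * m + i')).+1 == a * m + r)%N = (i' == mate m r i) && (q.+1 == power_size a r i).
Proof.
move=> hr hi hi'; rewrite /mate /power_size.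
(* Writing [q] and [a] through their difference makes the goal linear in the products. Only [q = a]
   and [a = q + 1] can satisfy the equation; the ranges of [i], [i'] and [r] exclude the rest. *)
have [d [ -> | -> ]] : exists d, (q = a + d)%N \/ (a = q + d.+1)%N.
  by case: (leqP a q) => h; [exists (q - a)%N; left | exists (a - q).-1; right]; lia.
- case: d => [|d]; first by rewrite addn0; case: (ltnP i r) => h; lia.
  have : (d.+1 * m >= m)%N by rewrite leq_pmull.
  by rewrite mulnDl; case: (ltnP i r) => h; lia.
- case: d => [|d]; first by rewrite mulnDl mul1n; case: (ltnP i r) => h; lia.
  have : (d.+2 * m >= 2 * m)%N by rewrite leq_mul2r; lia.
  by rewrite mulnDl; case: (ltnP i r) => h; lia.
Qed.

Definition inv_sqrt2 : C := ((Num.sqrt (2 : R))^-1)%:C%C.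

Lemma inv_sqrt2_conj : conjc inv_sqrt2 = inv_sqrt2.
Proof. exact: conjc_real. Qed.

Lemma inv_sqrt2_sqr : inv_sqrt2 * inv_sqrt2 + inv_sqrt2 * inv_sqrt2 = 1.
Proof.
rewrite -mulr2n -mulr_natr /inv_sqrt2 -rmorphM -invfM -expr2 sqr_sqrtr ?ler0n //.
by rewrite -(rmorph_nat (@real_complex R)) -rmorphM /= mulVf ?pnatr_eq0.
Qed.

(** * Hyperbolic pairs at the level of Gram matrices *)

Section Mix.
Variables (m r : nat).
Hypothesis hr : (0 < r <= m)%N.
Local Notation mt := (mate m r).

(* [mix] sends the hyperbolic pair [u_i, u_(mate i)] to [(u_i + u_(mate i)) / sqrt 2]
   and [(u_(mate i) - u_i) / sqrt 2], up to order, and fixes [u_i] if [mate i = i];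
   it is an involution. *)
Definition mix_self i : C :=
  if (i < mt i)%N then inv_sqrt2 else if i == mt i then 1 else - inv_sqrt2.
Definition mix_mate i : C := if i == mt i then 0 else inv_sqrt2.
Definition mate_sign i : C := if (i <= mt i)%N then 1 else -1.
(** The Gram matrix [g] after [mix] is applied on both sides; the coefficients are real, hence no
    conjugations. *)
Definition mixg (g : nat -> nat -> C) i i' : C :=
  mix_self i * mix_self i' * g i i' + mix_self i * mix_mate i' * g i (mt i') +
  (mix_mate i * mix_self i' * g (mt i) i' + mix_mate i * mix_mate i' * g (mt i) (mt i')).

Lemma mix_self_conj i : conjc (mix_self i) = mix_self i.
Proof.
rewrite /mix_self; case: ifP => _; first exact: inv_sqrt2_conj.
case: ifP => _; first exact: rmorph1.
by rewrite rmorphN; congr (- _); exact: inv_sqrt2_conj.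
Qed.

Lemma mix_mate_conj i : conjc (mix_mate i) = mix_mate i.
Proof. by rewrite /mix_mate; case: ifP => _; rewrite ?conjc0 ?inv_sqrt2_conj. Qed.

(** A hyperbolic plane has signature (1,1): one vector of each mixed pair gets the value [t i], the
    other [- t i], while a class equal to its mate keeps [t i]. *)
Lemma mixg_swap (t : nat -> C) i i' : (i < m)%N -> (i' < m)%N -> t (mt i) = t i ->
  mixg (fun i i' => if i' == mt i then t i else 0) i i' =
  if i == i' then mate_sign i * t i else 0.
Proof.
move=> hi hi' ht; rewrite /mixg mateK // ht.
have e1 : (mt i' == mt i) = (i == i').
  by apply/eqP/eqP => [/(congr1 mt)|->]; rewrite ?mateK.
have e2 : (mt i' == i) = (i' == mt i).
  by apply/eqP/eqP => [<-|->]; rewrite mateK.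
rewrite e1 e2 (eq_sym i' i).
case: (eqVneq i i') => [<-|ne].
  rewrite /mix_self /mix_mate /mate_sign; case: (ltngtP i (mt i)) => h; last by ring.
  - by rewrite !mulr0 add0r addr0 -mulrDl inv_sqrt2_sqr.
  - transitivity (- ((inv_sqrt2 * inv_sqrt2 + inv_sqrt2 * inv_sqrt2) * t i)); first by ring.
    by rewrite inv_sqrt2_sqr mulN1r mul1r.
case: (eqVneq i' (mt i)) => [ei|_]; last by ring.
rewrite ei in ne *; rewrite /mix_self /mix_mate mateK //.
by case: (ltngtP i (mt i)) ne => h // _; ring.
Qed.

(** The same coefficients work in the reverse direction because [mix] is an involution. *)
Lemma mixg_diag (t : nat -> C) i i' : (i < m)%N -> (i' < m)%N -> t (mt i) = t i ->
  mixg (fun i i' => if i == i' then mate_sign i * t i else 0) i i' =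
  if i' == mt i then t i else 0.
Proof.
move=> hi hi' ht; rewrite /mixg ht.
have e1 : (mt i == mt i') = (i == i').
  by apply/eqP/eqP => [/(congr1 mt)|->]; rewrite ?mateK.
have e2 : (i == mt i') = (mt i == i').
  by apply/eqP/eqP => [->|<-]; rewrite mateK.
rewrite e1 e2 (eq_sym i' (mt i)).
case: (eqVneq (mt i) i') => [<-|ne].
  rewrite /mix_self /mix_mate /mate_sign mateK //; case: (ltngtP i (mt i)) => h;
      last by rewrite ?eqxx; ring.
  - transitivity ((inv_sqrt2 * inv_sqrt2 + inv_sqrt2 * inv_sqrt2) * t i); first by ring.
    by rewrite inv_sqrt2_sqr mul1r.
  - transitivity ((inv_sqrt2 * inv_sqrt2 + inv_sqrt2 * inv_sqrt2) * t i); first by ring.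
    by rewrite inv_sqrt2_sqr mul1r.
case: (eqVneq i i') => [ei|_]; last by ring.
rewrite -ei in ne *; rewrite /mix_self /mix_mate /mate_sign mateK //.
by case: (ltngtP i (mt i)) ne => h // _; ring.
Qed.

Lemma mixg_ext (g g' : nat -> nat -> C) i i' : (i < m)%N -> (i' < m)%N ->
  (forall j j', (j < m)%N -> (j' < m)%N -> g j j' = g' j j') -> mixg g i i' = mixg g' i i'.
Proof. by move=> hi hi' hg; rewrite /mixg !hg ?mate_lt. Qed.

End Mix.

Lemma blocks_BS m t a r (eps : nat -> nat -> C) :
  blocks_B m t.+1 a r eps = blocks_B m t a r eps ++
    [seq (power_size (a t) (r t) i, eps t i) | i <- iota 0 m].
Proof. by rewrite /blocks_B -addn1 iotaD map_cat flatten_cat /= cats0 add0n. Qed.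

Lemma size_blocks m t a r (eps : nat -> nat -> C) :
  size (blocks_B m t a r eps) = (t * m)%N.
Proof.
elim: t => [|t IH] //; rewrite blocks_BS size_cat IH size_map size_iota mulSn; lia.
Qed.

Lemma nth_blocks m t a r (eps : nat -> nat -> C) j i : (j < t)%N -> (i < m)%N ->
  nth (0%N, 0) (blocks_B m t a r eps) (j * m + i) = (power_size (a j) (r j) i, eps j i).
Proof.
move=> + hi; elim: t => [|t IH] // hj; rewrite blocks_BS nth_cat size_blocks.
case: (ltnP j t) => h.
  rewrite ifT ?IH //.
  by rewrite (@leq_trans (j.+1 * m)) ?leq_mul2r ?h ?orbT // mulSn; lia.
have -> : j = t by lia.
rewrite ltnNge leq_addr /= addKn (nth_map 0%N) ?size_iota // nth_iota //.
Qed.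

Lemma total_size_blocks m t a r (eps : nat -> nat -> C) :
  (forall j, (j < t)%N -> (0 < r j <= m)%N) ->
  total_size (blocks_B m t a r eps) = sumn [seq (a j * m + r j)%N | j <- iota 0 t].
Proof.
elim: t => [|t IH] hr //; rewrite blocks_BS total_size_cat IH;
  last by move=> j hj; apply: hr; lia.
rewrite -addn1 iotaD map_cat sumn_cat /= addn0 add0n; congr (_ + _)%N.
have := hr t (ltnSn t); move: (a t) (r t) => a0 r0 hr0.
rewrite /total_size /unzip1 -map_comp /=.
have -> : m = (r0 + (m - r0))%N by lia.
rewrite iotaD map_cat sumn_cat add0n.
have sconst (c s N : nat) : (forall i, (s <= i < s + N)%N -> power_size a0 r0 i = c) ->
    sumn [seq power_size a0 r0 i | i <- iota s N] = (N * c)%N.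
  elim: N s => [|N IHN] s hc //=; rewrite hc ?leqnn ?addnS ?leq_addr //= IHN ?mulSn //.
  by move=> i hi; apply: hc; lia.
rewrite /= (sconst a0.+1) ?(sconst a0); last 2 first.
- by move=> i hi; rewrite /power_size ifF //; lia.
- by move=> i hi; rewrite /power_size ifT //; lia.
rewrite mulnDr (mulnC a0 (m - r0)%N) (mulnC a0 r0) mulnS; lia.
Qed.

(** The signs that a chain of sign [eta j] leaves on its residue classes; they serve as the normal
    form of balanced signs. *)
Definition std_sign (m : nat) (r : nat -> nat) (eta : nat -> C) (j i : nat) : C :=
  mate_sign m (r j) i * eta j.

Lemma power_size_mate m a r i : (0 < r <= m)%N -> (i < m)%N ->
    power_size a r (mate m r i) = power_size a r i.
Proof. by move=> hr hi; rewrite /power_size mate_class. Qed.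

End Mixing.

(** * Balanced lists of signs *)

Lemma balanced_perm (R : realType) (eta : R[i]) (l1 l2 : seq R[i]) :
  eta != 0 -> {in l1, forall x, x = eta \/ x = - eta} ->
  {in l2, forall x, x = eta \/ x = - eta} ->
  size l1 = size l2 -> balanced eta l1 -> balanced eta l2 -> perm_eq l1 l2.
Proof.
move=> ne h1 h2 hs b1 b2.
have nee : (- eta == eta) = false.
  apply/negbTE; rewrite eq_sym -addr_eq0 -mulr2n mulrn_eq0 /=; exact: ne.
have nee' : (eta == - eta) = false by rewrite eq_sym.
have cnt l : {in l, forall x, x = eta \/ x = - eta} ->
    (count (fun e => e == eta) l + count (fun e => e == - eta) l)%N = size l.
  elim: l => [|x l IH] hl //=.
  have := IH (fun y hy => hl y (mem_behead (s := x :: l) hy)).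
  case: (hl x (mem_head _ _)) => ->; rewrite eqxx ?nee ?nee' /= add0n => <-.
    by rewrite add1n addSn.
  by rewrite add1n addnS.
(* The length and the parity rule fix both counts, hence the multiset. *)
have [e1 e2] : count (fun e => e == eta) l1 = count (fun e => e == eta) l2 /\
    count (fun e => e == - eta) l1 = count (fun e => e == - eta) l2.
  have := cnt _ h1; have := cnt _ h2; move: b1 b2; rewrite /balanced hs.
  set p1 := count _ l1; set q1 := count _ l1; set p2 := count _ l2; set q2 := count _ l2.
  case: (odd _) => [[_ b1] [_ b2] | [b1 _] [b2 _]];
    have := b1 isT; have := b2 isT;
    clearbody p1 q1 p2 q2; move: (size l2) => N e1 e2 e3 e4; split; lia.
apply/allP => x; rewrite mem_cat => hx /=.
have [-> | ->] : x = eta \/ x = - eta by case/orP: hx => /[dup] ? => [/h1|/h2].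
- by rewrite (eq_count (a2 := fun e => e == eta)) // e1.
- by rewrite (eq_count (a2 := fun e => e == - eta)) // e2.
Qed.

(** For odd [N] the middle index satisfies [i.*2 < N], so the extra sign is [eta], as balance
    requires. *)
Lemma half_balanced (R : realType) (eta : R[i]) N (f : nat -> R[i]) : eta != 0 ->
  (forall i, (i < N)%N -> f i = if (i.*2 < N)%N then eta else - eta) ->
  balanced eta [seq f i | i <- iota 0 N].
Proof.
move=> ne hfE.
have nee : (- eta == eta) = false.
  apply/negbTE; rewrite eq_sym -addr_eq0 -mulr2n mulrn_eq0 /=; exact: ne.
have nee' : (eta == - eta) = false by rewrite eq_sym.
have eN : N = (uphalf N + N./2)%N by rewrite uphalf_half -addnA addnn odd_double_half.
have p1 : [seq f i | i <- iota 0 (uphalf N)] = nseq (uphalf N) eta.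
  apply: (@eq_from_nth _ 0); rewrite ?size_map ?size_iota ?size_nseq // => i hi.
  rewrite (nth_map 0%N) ?size_iota // nth_nseq hi nth_iota // add0n hfE; last by lia.
  by rewrite ifT //; move: hi; rewrite uphalf_half; have := odd_double_half N; lia.
have p2 : [seq f i | i <- iota (uphalf N) N./2] = nseq N./2 (- eta).
  apply: (@eq_from_nth _ 0); rewrite ?size_map ?size_iota ?size_nseq // => i hi.
  rewrite (nth_map 0%N) ?size_iota // nth_nseq hi nth_iota // hfE; last by lia.
  by rewrite ifF //; rewrite uphalf_half; have := odd_double_half N; lia.
have eM : [seq f i | i <- iota 0 N] = nseq (uphalf N) eta ++ nseq N./2 (- eta).
  by rewrite {1}eN iotaD map_cat add0n p1 p2.
rewrite /balanced size_map size_iota eM.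
rewrite !count_cat !count_nseq /= ?eqxx ?nee ?nee' ?mul1n ?mul0n ?addn0 ?add0n.
rewrite uphalf_half; by case: (odd N); split.
Qed.

Lemma mate_sign_half (R : realType) m r i : (0 < r <= m)%N -> (i < r)%N ->
  mate_sign R m r i = if (i.*2 < r)%N then 1 else -1.
Proof. by move=> hr hi; rewrite /mate_sign /mate hi; congr (if _ then _ else _); lia. Qed.

Lemma mate_sign_half2 (R : realType) m r i : (0 < r <= m)%N -> (i < m - r)%N ->
  mate_sign R m r (r + i) = if (i.*2 < m - r)%N then 1 else -1.
Proof.
move=> hr hi; rewrite /mate_sign /mate ltnNge leq_addr /=; congr (if _ then _ else _); lia.
Qed.

Lemma mate_sign_pm (R : realType) m r i (eta : R[i]) :
  mate_sign R m r i * eta = eta \/ mate_sign R m r i * eta = - eta.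
Proof. by rewrite /mate_sign; case: ifP => _; [left | right]; rewrite ?mulN1r ?mul1r. Qed.

Lemma std_sign_balanced (R : realType) m r (eta : R[i]) : (0 < r <= m)%N -> eta != 0 ->
  balanced eta [seq mate_sign R m r i * eta | i <- iota 0 r] /\
  balanced eta [seq mate_sign R m r i * eta | i <- iota r (m - r)].
Proof.
move=> hr ne; split.
  by apply: half_balanced => // i hi; rewrite mate_sign_half //; case: ifP;
      rewrite ?mul1r ?mulN1r.
rewrite -[r in iota r]addn0 iotaDl -map_comp.
apply: half_balanced => // i hi /=; rewrite mate_sign_half2 //.
by case: ifP; rewrite ?mul1r ?mulN1r.
Qed.

Lemma pm_neq0 (R : realType) (e : R[i]) : e = 1 \/ e = -1 -> e != 0.
Proof. by case=> ->; rewrite ?oppr_eq0 oner_eq0. Qed.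

(** Blocks of size [a j + 1] and of size [a j] are permuted separately: within each group, balance
    determines the multiset of signs. *)
Lemma blocks_std (R : realType) m t a r (eps : nat -> nat -> R[i]) (eta : nat -> R[i]) :
  (forall j, (j < t)%N -> (0 < r j <= m)%N) ->
  (forall j i, (j < t)%N -> (i < m)%N -> eps j i = 1 \/ eps j i = -1) ->
  (forall j, (j < t)%N -> (eta j = 1 \/ eta j = -1) /\
      balanced (eta j) [seq eps j i | i <- iota 0 (r j)] /\
      balanced (eta j) [seq eps j i | i <- iota (r j) (m - r j)]) ->
  perm_eq (blocks_B m t a r eps) (blocks_B m t a r (std_sign m r eta)).
Proof.
move=> hr he hb; elim: t hr he hb => [|t IH] hr he hb //.
rewrite !blocks_BS perm_cat ?IH //; try by move=> *; (apply: hr || apply: he || apply: hb); lia.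
have hrt := hr t (ltnSn t); have [eta1 [b1 b2]] := hb t (ltnSn t).
have ne := pm_neq0 eta1; have [c1 c2] := std_sign_balanced hrt ne.
have hpm i : (i < m)%N -> eps t i = eta t \/ eps t i = - eta t.
  move=> hi; have [-> | ->] := he t i (ltnSn t) hi; case: eta1 => ->;
    rewrite ?opprK; by [left | right].
have em : m = (r t + (m - r t))%N by lia.
rewrite em iotaD !map_cat -em add0n.
have part s N c : (s + N <= m)%N ->
    (forall i, (s <= i < s + N)%N -> power_size (a t) (r t) i = c) ->
    balanced (eta t) [seq eps t i | i <- iota s N] ->
    balanced (eta t) [seq mate_sign R m (r t) i * eta t | i <- iota s N] ->
    perm_eq [seq (power_size (a t) (r t) i, eps t i) | i <- iota s N]
            [seq (power_size (a t) (r t) i, std_sign m r eta t i) | i <- iota s N].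
  move=> hs hc d1 d2.
  have ek (g : nat -> R[i]) : [seq (power_size (a t) (r t) i, g i) | i <- iota s N] =
      map (pair c) [seq g i | i <- iota s N].
    by rewrite -map_comp; apply/eq_in_map => i; rewrite mem_iota => hi /=; rewrite hc.
  rewrite !ek; apply: perm_map; apply: (balanced_perm ne) => //.
  - by move=> x /mapP[l]; rewrite mem_iota => hl ->; apply: hpm; lia.
  - by move=> x /mapP[l _ ->]; apply: mate_sign_pm.
  - by rewrite !size_map.
apply: perm_cat.
- by apply: (part _ _ (a t).+1) => //; [lia | move=> i hi; rewrite /power_size ifT //; lia].
- by apply: (part _ _ (a t)) => //; [lia | move=> i hi; rewrite /power_size ifF //; lia].
Qed.

Lemma perm_halves (T : eqType) (s1 s2 : seq T) :
  perm_eq (s1 ++ s1) (s2 ++ s2) -> perm_eq s1 s2.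
Proof.
move=> /permP h; apply/permP => P; have := h P; rewrite !count_cat; lia.
Qed.

(** * The quaternionic structure *)

Section ConjAdj.
Variable R : realType.
Local Notation C := R[i].

Lemma cconjmxM m n p (A : 'M[C]_(m, n)) (B : 'M[C]_(n, p)) :
  cconjmx (A *m B) = cconjmx A *m cconjmx B.
Proof. exact: map_mxM. Qed.

Lemma cconjmxK m n (A : 'M[C]_(m, n)) : cconjmx (cconjmx A) = A.
Proof. by apply/matrixP => i j; rewrite !mxE conjcK. Qed.

Lemma cconjmxN m n (A : 'M[C]_(m, n)) : cconjmx (- A) = - cconjmx A.
Proof. exact: map_mxN. Qed.

Lemma cconjmxD m n (A B : 'M[C]_(m, n)) : cconjmx (A + B) = cconjmx A + cconjmx B.
Proof. exact: map_mxD. Qed.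

Lemma cconjmxZ m n (c : C) (A : 'M[C]_(m, n)) : cconjmx (c *: A) = conjc c *: cconjmx A.
Proof. exact: map_mxZ. Qed.

Lemma cconjmx_inv n (A : 'M[C]_n) : cconjmx (invmx A) = invmx (cconjmx A).
Proof. exact: map_invmx. Qed.

Lemma cconjmx_tr m n (A : 'M[C]_(m, n)) : (cconjmx A)^T = cconjmx A^T.
Proof. by apply/matrixP => i j; rewrite !mxE. Qed.

Lemma cadjmxM m n p (A : 'M[C]_(m, n)) (B : 'M[C]_(n, p)) :
  cadjmx (A *m B) = cadjmx B *m cadjmx A.
Proof. by rewrite /cadjmx cconjmxM trmx_mul. Qed.

Lemma cadjmxK m n (A : 'M[C]_(m, n)) : cadjmx (cadjmx A) = A.
Proof. by rewrite /cadjmx cconjmx_tr trmxK cconjmxK. Qed.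

Lemma cadjmx_row m n1 n2 (A : 'M[C]_(m, n1)) (B : 'M[C]_(m, n2)) :
  cadjmx (row_mx A B) = col_mx (cadjmx A) (cadjmx B).
Proof. by rewrite /cadjmx /cconjmx map_row_mx tr_row_mx. Qed.

Lemma cadjmx_unit n (A : 'M[C]_n) : A \in unitmx -> cadjmx A \in unitmx.
Proof. by rewrite /cadjmx unitmx_tr map_unitmx. Qed.

(* The quaternionic structure [v |-> K v^conj]: it is conjugate-linear with
   square [-1], and [Omega] is the set of matrices commuting with it. *)
Definition Kmx n : 'M[C]_(n + n) := block_mx 0 (- 1%:M) 1%:M 0.
Definition jconj n s (X : 'M[C]_(n + n, s)) : 'M[C]_(n + n, s) := Kmx n *m cconjmx X.

Lemma Kmx_conj n : cconjmx (Kmx n) = Kmx n.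
Proof.
by rewrite /cconjmx /Kmx map_block_mx map_mxN map_mx1 !map_mx0.
Qed.

Lemma Kmx_tr n : (Kmx n)^T = - Kmx n.
Proof.
by rewrite /Kmx tr_block_mx opp_block_mx linearN /= !trmx1 !trmx0 oppr0 opprK.
Qed.

Lemma Kmx_sqr n : Kmx n *m Kmx n = - 1%:M.
Proof.
rewrite /Kmx mulmx_block !(mul0mx, mulmx0, mulmx1, mul1mx) !(oppr0, addr0, add0r).
by rewrite (scalar_mx_block n n) opp_block_mx oppr0.
Qed.

Lemma Kmx_adj n : cadjmx (Kmx n) = - Kmx n.
Proof. by rewrite /cadjmx Kmx_conj Kmx_tr. Qed.

Lemma jconjK n s (X : 'M[C]_(n + n, s)) : jconj (jconj X) = - X.
Proof. by rewrite /jconj cconjmxM Kmx_conj cconjmxK mulmxA Kmx_sqr mulNmx mul1mx. Qed.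

Lemma omegaP n (A : 'M[C]_(n + n)) : inOmega A <-> A *m Kmx n = Kmx n *m cconjmx A.
Proof.
split=> [[A1 [A2 ->]] | ].
  rewrite /cconjmx /Kmx map_block_mx !mulmx_block.
  rewrite !(mulmx0, mul0mx, mulNmx, mulmxN, mulmx1, mul1mx) !(addr0, add0r) map_mxN.
  by rewrite -!/(cconjmx _) !cconjmxK ?opprK.
rewrite -{1 2}[A]submxK /cconjmx map_block_mx /Kmx !mulmx_block.
rewrite !(mulmx0, mul0mx, mulNmx, mulmxN, mulmx1, mul1mx) !(addr0, add0r).
rewrite -!/(cconjmx _) => /eq_block_mx [e1 e2 e3 e4].
exists (ulsubmx A), (- dlsubmx A).
by rewrite -{1}[A]submxK opprK cconjmxN -e1 -e3.
Qed.

Lemma jconj_mul n s (A : 'M[C]_(n + n)) (X : 'M[C]_(n + n, s)) : inOmega A ->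
  jconj (A *m X) = A *m jconj X.
Proof. by move/omegaP=> e; rewrite /jconj cconjmxM !mulmxA e. Qed.

Lemma omegaM n (A B : 'M[C]_(n + n)) : inOmega A -> inOmega B -> inOmega (A *m B).
Proof.
move=> /omegaP hA /omegaP hB; apply/omegaP.
by rewrite cconjmxM -mulmxA hB !mulmxA hA.
Qed.

Lemma omega1 n : inOmega (1%:M : 'M[C]_(n + n)).
Proof. by apply/omegaP; rewrite /cconjmx map_mx1 mulmx1 mul1mx. Qed.

Lemma omegaX n (A : 'M[C]_(n + n)) q : inOmega A -> inOmega (A ^+ q).
Proof.
move=> hA; elim: q => [|q IH]; first by rewrite expr0; apply: omega1.
by rewrite exprS; apply: omegaM.
Qed.

Lemma omegaV n (A : 'M[C]_(n + n)) : A \in unitmx -> inOmega A -> inOmega (invmx A).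
Proof.
move=> uA /omegaP hA; apply/omegaP; rewrite cconjmx_inv.
have uA' : cconjmx A \in unitmx by rewrite map_unitmx.
have : invmx A *m (A *m Kmx n) *m invmx (cconjmx A) =
       invmx A *m (Kmx n *m cconjmx A) *m invmx (cconjmx A) by rewrite hA.
by rewrite mulKmx // mulmxA mulmxK.
Qed.

Lemma omega_adj n (A : 'M[C]_(n + n)) : inOmega A -> inOmega (cadjmx A).
Proof.
move/omegaP=> hA; apply/omegaP.
have := congr1 (@cadjmx R _ _) hA; rewrite !cadjmxM Kmx_adj mulNmx mulmxN => /oppr_inj.
move/(congr1 (@cconjmx R _ _)); rewrite !cconjmxM Kmx_conj => ->.
by rewrite /cadjmx !cconjmx_tr cconjmxK.
Qed.

(** Together with [omega_row], this identifies the elements of [Omega] with their left halves. *)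
Lemma jconj_omega n (X : 'M[C]_(n + n, n)) : inOmega (row_mx X (jconj X)).
Proof.
exists (usubmx X), (- dsubmx X).
rewrite /jconj -{1 2}[X]vsubmxK /cconjmx map_col_mx /Kmx mul_block_col !mul0mx.
rewrite mulNmx !mul1mx add0r addr0 map_mxN opprK.
by rewrite block_mxEh.
Qed.

Lemma omega_row n (S : 'M[C]_(n + n)) : inOmega S ->
  S = row_mx (lsubmx S) (jconj (lsubmx S)).
Proof.
case=> A1 [A2 ->]; rewrite {1}block_mxEh; congr row_mx.
  by rewrite block_mxEh row_mxKl.
rewrite [in RHS]block_mxEh row_mxKl /jconj /cconjmx map_col_mx /Kmx mul_block_col.
by rewrite !mul0mx mulNmx !mul1mx add0r addr0 map_mxN opprK.
Qed.

End ConjAdj.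

(** * Indefinite forms and chains *)

Section Form.
Variables (R : realType) (n : nat).
Local Notation C := R[i].
Variable H : 'M[C]_(n + n).
Hypotheses (OH : inOmega H) (hH : is_hermitian H).
Local Notation V := 'cV[C]_(n + n).

Definition hform (u v : V) : C := (cadjmx u *m H *m v) 0 0.

Lemma hformDr u v w : hform u (v + w) = hform u v + hform u w.
Proof. by rewrite /hform mulmxDr mxE. Qed.

Lemma hformZr c u v : hform u (c *: v) = c * hform u v.
Proof. by rewrite /hform -scalemxAr mxE. Qed.

Lemma hformC u v : conjc (hform u v) = hform v u.
Proof.
have e : cadjmx (cadjmx u *m H *m v) = cadjmx v *m H *m u.
  by rewrite !cadjmxM cadjmxK hH mulmxA.
by rewrite /hform -e !mxE.
Qed.

Lemma hformDl u v w : hform (u + v) w = hform u w + hform v w.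
Proof. by rewrite -!(hformC w) hformDr rmorphD. Qed.

Lemma hformZl c u v : hform (c *: u) v = conjc c * hform u v.
Proof. by rewrite -!(hformC v) hformZr rmorphM. Qed.

Lemma hform0r u : hform u 0 = 0.
Proof. by rewrite /hform mulmx0 mxE. Qed.

Lemma hform0l u : hform 0 u = 0.
Proof. by rewrite -hformC hform0r conjc0. Qed.

Lemma hformNr u v : hform u (- v) = - hform u v.
Proof. by rewrite -scaleN1r hformZr mulN1r. Qed.

(** [H] commutes with [j] and [Kmx] is unitary, so [j] preserves the form up to conjugation. *)
Lemma gram_jconj s s' (X : 'M[C]_(n + n, s)) (Y : 'M[C]_(n + n, s')) :
  cadjmx (jconj X) *m H *m jconj Y = cconjmx (cadjmx X *m H *m Y).
Proof.
have /omegaP e := OH; rewrite /jconj cadjmxM Kmx_adj.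
rewrite mulmxN !mulNmx -!mulmxA (mulmxA H) e !mulmxA.
rewrite -(mulmxA _ (Kmx R n) (Kmx R n)) Kmx_sqr.
by rewrite mulmxN mulmx1 !mulNmx opprK !cconjmxM /cadjmx cconjmx_tr.
Qed.

Lemma hform_jconj u v : hform (jconj u) (jconj v) = conjc (hform u v).
Proof. by rewrite /hform gram_jconj mxE. Qed.

Lemma hform_jconjl u v : hform (jconj u) v = - conjc (hform u (jconj v)).
Proof. by rewrite -hform_jconj jconjK hformNr opprK. Qed.

Lemma hform_jconjr u v : hform u (jconj v) = - hform v (jconj u).
Proof. by rewrite -(hformC (jconj u) v) hform_jconjl rmorphN /= conjcK opprK. Qed.

Section SelfAdjoint.
Variable A : 'M[C]_(n + n).
Hypotheses (OA : inOmega A) (sA : H_selfadjoint H A).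

Lemma hform_adj u v : hform u (A *m v) = hform (A *m u) v.
Proof. by rewrite /hform cadjmxM -!mulmxA (mulmxA H) sA !mulmxA. Qed.

Lemma selfadjointX q : H_selfadjoint H (A ^+ q).
Proof.
rewrite /H_selfadjoint; elim: q => [|q IH].
  by rewrite expr0 mulmx1 /cadjmx /cconjmx map_mx1 trmx1 mul1mx.
by rewrite {1}exprS exprSr -!mulmxE cadjmxM mulmxA sA -!mulmxA IH.
Qed.

End SelfAdjoint.

Lemma hform_adjX A q u v : H_selfadjoint H A -> hform u (A ^+ q *m v) = hform (A ^+ q *m u) v.
Proof. by move=> sA; apply/hform_adj/selfadjointX. Qed.

(* [(u, v) |-> h(u, A^q v^j)] is an alternating form. *)
Lemma hform_jconj_self A q u : inOmega A -> H_selfadjoint H A ->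
  hform u (A ^+ q *m jconj u) = 0.
Proof.
move=> OA sA; have e : hform u (A ^+ q *m jconj u) = - hform u (A ^+ q *m jconj u).
  rewrite -{1}(jconj_mul _ (omegaX q OA)) hform_jconjr.
  by rewrite (hform_adjX q u (jconj u) sA).
move: (hform _ _) e => x /eqP.
by rewrite -addr_eq0 -mulr2n mulrn_eq0 /= => /eqP.
Qed.

(** * Families of vectors, their Gram matrices, and chains *)

Implicit Types (L : seq (nat * C)) (A : 'M[C]_(n + n)).

Definition fam_mx L (f : nat -> nat -> V) s : 'M[C]_(n + n, s) :=
  \matrix_(a, p) f (loc (unzip1 L) p).1 (loc (unzip1 L) p).2 a 0.

Lemma mul_fam A L f s : A *m fam_mx L f s = fam_mx L (fun i l => A *m f i l) s.
Proof.
apply/matrixP => a p; rewrite !mxE; apply: eq_bigr => j _.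
by rewrite mxE.
Qed.

Lemma jconj_fam L f s : jconj (fam_mx L f s) = fam_mx L (fun i l => jconj (f i l)) s.
Proof.
by rewrite -mul_fam; congr (_ *m _); apply/matrixP => a p; rewrite !mxE.
Qed.

Lemma gram_fam L f g s : cadjmx (fam_mx L f s) *m H *m fam_mx L g s =
  \matrix_(p, q) hform (f (loc (unzip1 L) p).1 (loc (unzip1 L) p).2)
                    (g (loc (unzip1 L) q).1 (loc (unzip1 L) q).2).
Proof.
apply/matrixP => p q; rewrite [RHS]mxE /hform [LHS]mxE [RHS]mxE; apply: eq_bigr => j _.
rewrite [in RHS]mxE [fam_mx _ _ _ _ _]mxE; congr (_ * _); rewrite [LHS]mxE.
by apply: eq_bigr => k _; rewrite !mxE.
Qed.

Lemma gram_fam1 L f s (v : V) p : (cadjmx (fam_mx L f s) *m H *m v) p 0 =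
  hform (f (loc (unzip1 L) p).1 (loc (unzip1 L) p).2) v.
Proof.
rewrite /hform [LHS]mxE [RHS]mxE; apply: eq_bigr => j _.
congr (_ * _); rewrite [LHS]mxE [RHS]mxE.
by apply: eq_bigr => k _; rewrite !mxE.
Qed.

(** Half of an adapted basis: the other half is [jconj X], and the second condition makes the two
    halves orthogonal. *)
Definition frame L s (X : 'M[C]_(n + n, s)) : Prop :=
  cadjmx X *m H *m X = Qmx L s /\ cadjmx X *m H *m jconj X = 0.

Lemma frame_gram L s (X : 'M[C]_(n + n, s)) : total_size L = s -> signs L -> frame L X ->
  cadjmx (row_mx X (jconj X)) *m H *m row_mx X (jconj X) =
  block_mx (Qmx L s) 0 0 (Qmx L s).
Proof.
move=> e hL [e1 e2]; rewrite cadjmx_row mul_col_mx mul_col_row gram_jconj e1 e2.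
rewrite signs_conj //; congr block_mx.
have := congr1 (@cadjmx R _ _) e2; rewrite !cadjmxM cadjmxK hH mulmxA => ->.
by rewrite /cadjmx /cconjmx map_mx0 trmx0.
Qed.

Lemma block_Qmx_sqr L s : total_size L = s -> signs L ->
  block_mx (Qmx L s) 0 0 (Qmx L s) *m block_mx (Qmx L s) 0 0 (Qmx L s) = 1%:M.
Proof.
move=> e hL; rewrite mulmx_block !(mulmx0, mul0mx, addr0, add0r).
by rewrite Qmx_sqr // -?scalar_mx_block //; apply: signs_sqr.
Qed.

(** The Gram matrix is its own inverse, which exhibits a left inverse of this square matrix. *)
Lemma frame_unit L (X : 'M[C]_(n + n, n)) : total_size L = n -> signs L -> frame L X ->
  row_mx X (jconj X) \in unitmx.
Proof.
move=> e hL fX; have := block_Qmx_sqr e hL; rewrite -{2}(frame_gram e hL fX) mulmxA.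
by case/mulmx1_unit.
Qed.

Lemma frame_mul L B (X : 'M[C]_(n + n, n)) : total_size L = n -> inOmega B ->
  B *m X = X *m Jmx L n ->
  B *m row_mx X (jconj X) = row_mx X (jconj X) *m Jmx (L ++ L) (n + n).
Proof.
move=> e OB eX; rewrite (Jmx_cat e e) mul_mx_row mul_row_block !mulmx0 addr0 add0r -eX.
congr row_mx; rewrite -jconj_mul // eX /jconj cconjmxM mulmxA; congr (_ *m _).
by apply/matrixP => p q; rewrite !mxE /Jent conjc_nat.
Qed.

Definition chains A L (x : nat -> V) : Prop :=
  [/\ forall i j q, (i < size L)%N -> (j < size L)%N ->
        hform (x i) (A ^+ q *m x j) = if (i == j) && (q.+1 == block_size L i) then
            block_sign L i else 0,
      forall i j q, (i < size L)%N -> (j < size L)%N ->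
        hform (x i) (A ^+ q *m jconj (x j)) = 0
    & forall i, (i < size L)%N -> A ^+ block_size L i *m x i = 0].

(** The generator sits at the last offset, so that [A] lowers the offset by one, as [jordan0]
    does. *)
Definition chain_fam A L (x : nat -> V) (i l : nat) : V := A ^+ (block_size L i - l.+1) *m x i.

Lemma mulmx_expD A p q (v : V) : A ^+ p *m (A ^+ q *m v) = A ^+ (p + q) *m v.
Proof. by rewrite mulmxA exprD. Qed.

Lemma mulmx_expS A q (v : V) : A ^+ q.+1 *m v = A *m (A ^+ q *m v).
Proof. by rewrite exprS mulmxA. Qed.

(** Offsets [l] and [l'] in a block of size [k] pair through the moment of order
    [(k - 1 - l) + (k - 1 - l')], which equals [k - 1] exactly on the antidiagonal
    [l + l' = k - 1]. *)
Lemma chains_frame A L x s : inOmega A -> H_selfadjoint H A -> total_size L = s ->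
  chains A L x -> frame L (fam_mx L (chain_fam A L x) s) /\
  A *m fam_mx L (chain_fam A L x) s = fam_mx L (chain_fam A L x) s *m Jmx L s.
Proof.
move=> OA sA e [h1 h2 h3]; subst s; split; first split.
- rewrite gram_fam; apply/matrixP => p q; rewrite !mxE /Qent.
  have [hi hl] := loc_block_size (ltn_ord p); have [hj hl'] := loc_block_size (ltn_ord q).
  rewrite /chain_fam -(hform_adjX _ _ _ sA) mulmx_expD h1 // -/(block_size L _).
  case: eqP => //= eij; rewrite -eij in hl' *.
  by congr (if _ then _ else _); lia.
- rewrite jconj_fam gram_fam; apply/matrixP => p q; rewrite !mxE.
  have [hi hl] := loc_block_size (ltn_ord p); have [hj hl'] := loc_block_size (ltn_ord q).
  rewrite /chain_fam jconj_mul; last exact: omegaX.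
  by rewrite -(hform_adjX _ _ _ sA) mulmx_expD h2.
- rewrite mul_fam; apply/matrixP => a q; rewrite mulmx_Jmx // [LHS]mxE.
  have [hj hl] := loc_block_size (ltn_ord q).
  rewrite /chain_fam -[A in A *m (_ *m _)]expr1 mulmx_expD.
  case: ifP => h; last first.
    rewrite (_ : 1 + _ = block_size L (loc (unzip1 L) q).1)%N; last by lia.
    by rewrite h3 // mxE.
  have [q0 hq] := loc_pred (ltn_ord q) h.
  have hv : insubd q (q : nat).-1 = q.-1 :> nat.
    by rewrite val_insubd ifT // (leq_ltn_trans (leq_pred _)).
  move: (insubd _ _) hv => q' hv.
  rewrite [RHS]mxE hv hq /=; congr ((_ ^+ _ *m _) _ _); lia.
Qed.

(* A system of chains that does not span the whole space can be enlarged inside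
   the orthogonal complement of its span. *)
Section Growth.
Variables (A : 'M[C]_(n + n)) (L : seq (nat * C)) (x : nat -> V).
Hypotheses (OA : inOmega A) (sA : H_selfadjoint H A) (cA : chains A L x) (sL : signs L).

(** All exponents [q] are allowed, so invariance under [A] is immediate; [W_in_orth] shows that
    those below the block sizes suffice. *)
Definition in_orth (u : V) : Prop := forall i q, (i < size L)%N ->
  hform (A ^+ q *m x i) u = 0 /\ hform (A ^+ q *m jconj (x i)) u = 0.

Lemma in_orthD u v : in_orth u -> in_orth v -> in_orth (u + v).
Proof.
move=> hu hv i q hi; have [e1 e2] := hu i q hi; have [e3 e4] := hv i q hi.
by rewrite !hformDr e1 e2 e3 e4 addr0.
Qed.

Lemma in_orthZ c u : in_orth u -> in_orth (c *: u).
Proof. by move=> hu i q hi; have [e1 e2] := hu i q hi; rewrite !hformZr e1 e2 mulr0. Qed.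

Lemma in_orthX q u : in_orth u -> in_orth (A ^+ q *m u).
Proof.
move=> hu i p hi; rewrite !hform_adjX // !mulmx_expD.
exact: hu.
Qed.

Let X : 'M[C]_(n + n, total_size L) := fam_mx L (chain_fam A L x) (total_size L).
Let W : 'M[C]_(n + n, total_size L + total_size L) := row_mx X (jconj X).
Let G : 'M[C]_(total_size L + total_size L) :=
    block_mx (Qmx L (total_size L)) 0 0 (Qmx L (total_size L)).
(* The projection onto the orthogonal complement of the columns of [W]. *)
Let P : 'M[C]_(n + n) := 1%:M - W *m G *m cadjmx W *m H.

Lemma in_orth_W u : in_orth u -> cadjmx W *m H *m u = 0.
Proof.
move=> hu; rewrite /W cadjmx_row !mul_col_mx.
have -> : cadjmx X *m H *m u = 0.
  apply/matrixP => p j; rewrite ord1 /X gram_fam1 mxE /chain_fam.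
  have [hi _] := loc_block_size (ltn_ord p).
  set q := (_ - _)%N; by have [] := hu _ q hi.
have -> : cadjmx (jconj X) *m H *m u = 0.
  apply/matrixP => p j; rewrite ord1 /X jconj_fam gram_fam1 mxE /chain_fam.
  rewrite jconj_mul; last exact: omegaX.
  have [hi _] := loc_block_size (ltn_ord p).
  set q := (_ - _)%N; by have [] := hu _ q hi.
by rewrite col_mx0.
Qed.

Lemma W_in_orth u : cadjmx W *m H *m u = 0 -> in_orth u.
Proof.
rewrite /W cadjmx_row !mul_col_mx -[0]vsubmxK => /eq_col_mx[e1 e2] i q hi.
have [_ _ h3] := cA.
case: (ltnP q (block_size L i)) => hq; last first.
  rewrite -jconj_mul; last exact: omegaX.
  rewrite -(subnK hq) -mulmx_expD h3 // mulmx0 /jconj /cconjmx map_mx0 mulmx0.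
  by rewrite hform0l.
have hl : (block_size L i - q.+1 < block_size L i)%N by lia.
have [hp elp] := loc_start_block hi hl; pose p := Ordinal hp.
have eq : (block_size L i - (block_size L i - q.+1).+1 = q)%N by lia.
split.
- have /matrixP /(_ p 0) := e1; rewrite /X gram_fam1 !mxE elp /chain_fam /=.
  by rewrite eq.
- have /matrixP /(_ p 0) := e2; rewrite /X jconj_fam gram_fam1 !mxE elp /chain_fam /=.
  by rewrite eq jconj_mul //; apply: omegaX.
Qed.

Lemma gram_chains : cadjmx W *m H *m W = G.
Proof. by apply: frame_gram => //; have [] := chains_frame OA sA erefl cA. Qed.

Lemma gram_sqr : G *m G = 1%:M.
Proof. exact: block_Qmx_sqr. Qed.

Lemma P_in_orth v : in_orth (P *m v).
Proof.
apply: W_in_orth; rewrite /P mulmxBl mul1mx mulmxBr !mulmxA gram_chains gram_sqr mul1mx.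
by rewrite subrr.
Qed.

(** [u - P u] lies in the span of [W], which is orthogonal to [v]. *)
Lemma hform_P u v : in_orth v -> hform (P *m u) v = hform u v.
Proof.
move=> hv; rewrite /P mulmxBl mul1mx hformDl // -[X in _ = X]addr0; congr (_ + _).
rewrite -hformC // hformNr -!mulmxA.
set z := G *m _; have -> : hform v (W *m z) = 0.
  rewrite -hformC // {1}/hform cadjmxM -!mulmxA (mulmxA (cadjmx W)) in_orth_W // mulmx0 mxE.
  by rewrite conjc0.
by rewrite oppr0 conjc0.
Qed.

Lemma total_size_chains : (total_size L <= n)%N.
Proof.
have : (G *m cadjmx W *m H) *m W = 1%:M by rewrite -!mulmxA (mulmxA (cadjmx W)) gram_chains
    gram_sqr.
move/mulmx1_min; lia.
Qed.

(** [P = 0] would factor the identity of size [2 n] through a space of smaller dimension. *)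
Lemma P_neq0 : (total_size L < n)%N -> P != 0.
Proof.
move=> hs; apply/eqP => /eqP; rewrite subr_eq0 => /eqP/esym.
rewrite -!mulmxA => /mulmx1_min; lia.
Qed.

Lemma polarize k a b : hform a (A ^+ k *m b) != 0 ->
  exists c d : C, hform (c *: a + d *: b) (A ^+ k *m (c *: a + d *: b)) != 0.
Proof.
move=> hab; pose g u v := hform u (A ^+ k *m v).
have gexp c d : hform (c *: a + d *: b) (A ^+ k *m (c *: a + d *: b)) =
   conjc c * c * g a a + conjc c * d * g a b + (conjc d * c * g b a + conjc d * d * g b b).
  by rewrite mulmxDr -!scalemxAr !hformDr !hformDl // !hformZr !hformZl // -!/(g _ _); ring.
case: (eqVneq (g a a) 0) => [ga | ga]; last first.
  by exists 1, 0; rewrite gexp !(mulr0, mul0r, conjc0, conjc1, mul1r, addr0).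
case: (eqVneq (g b b) 0) => [gb | gb]; last first.
  by exists 0, 1; rewrite gexp !(mulr0, mul0r, conjc0, conjc1, mul1r, addr0, add0r).
case: (eqVneq (g a b + g b a) 0) => [g1 | g1]; last first.
  by exists 1, 1; rewrite gexp ga gb !(mulr0, conjc1, mul1r, addr0, add0r).
(* In the remaining case [g b a = - g a b], and the value at [a + i b] is [2 i g(a, b)]. *)
exists 1, 'i%C; rewrite gexp ga gb !(mulr0, conjc1, mul1r, mulr1, addr0, add0r).
have -> : conjc 'i%C = - 'i%C :> C by apply/eqP; rewrite eq_complex /= oppr0 !eqxx.
rewrite mulNr -mulrBr (_ : g b a = - g a b); last by apply/eqP; rewrite -addr_eq0 addrC g1.
rewrite opprK -mulr2n mulf_neq0 //; first by rewrite eq_complex /= oner_eq0 andbF.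
by rewrite mulrn_eq0 /=.
Qed.

Lemma real_unit_scale (c : C) : conjc c = c -> c != 0 ->
  exists t : C, conjc t = t /\ (t * t * c = 1 \/ t * t * c = -1).
Proof.
case: c => a b [] /eqP; rewrite eqNr => /eqP -> nz.
have na : a != 0 by apply: contra nz => /eqP ->.
exists ((Num.sqrt `|a|)^-1)%:C%C; split; first by rewrite conjc_real.
have e : (Num.sqrt `|a|)^-1 * (Num.sqrt `|a|)^-1 * a = Num.sg a.
  rewrite -invfM -expr2 sqr_sqrtr // mulrC {1}[a]numEsg mulfK //.
  by rewrite normr_eq0.
have -> : ((Num.sqrt `|a|)^-1)%:C%C * ((Num.sqrt `|a|)^-1)%:C%C * (a +i* 0)%C =
   (Num.sg a)%:C%C :> C by rewrite -e; simpc.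
case/lt_total/orP: na => h; first by right; rewrite ltr0_sg // rmorphN rmorph1.
by left; rewrite gtr0_sg.
Qed.

(* Adding a multiple of [A^j u] to [u] kills the moment [h(u, A^(k-1-j) u)] and
   leaves the higher ones unchanged. *)
Lemma normalize (k : nat) (e : C) (u : V) : (0 < k)%N -> e = 1 \/ e = -1 ->
  in_orth u -> A ^+ k *m u = 0 -> hform u (A ^+ k.-1 *m u) = e ->
  exists v, [/\ in_orth v, A ^+ k *m v = 0 &
    forall q, hform v (A ^+ q *m v) = if q.+1 == k then e else 0].
Proof.
move=> k0 he hu ku eu.
(* Induction from the top moment downwards: [j] counts the moments already cleared below it. *)
suff key j : (j <= k.-1)%N -> exists v, [/\ in_orth v, A ^+ k *m v = 0 &
    forall q, (k.-1 - j <= q)%N ->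
      hform v (A ^+ q *m v) = if q.+1 == k then e else 0].
  have [v [h1 h2 h3]] := key _ (leqnn k.-1).
  by exists v; split => // q; apply: h3; lia.
have e2 : e * e = 1 by case: he => ->; rewrite ?mulrNN mulr1.
have ec : conjc e = e by case: he => ->; rewrite ?rmorphN rmorph1.
elim: j => [|j IH] hj.
  exists u; split => // q hq; case: eqP => [ek | ne].
    by rewrite -eu -ek.
  have hk : (k <= q)%N by lia.
  by rewrite -(subnK hk) -mulmx_expD ku mulmx0 hform0r.
have [v [h1 h2 h3]] := IH (ltnW hj).
set q0 := (k.-1 - j.+1)%N; set c := hform v (A ^+ q0 *m v).
have cc : conjc c = c by rewrite /c hformC // -hform_adjX.
(* At [q0] the middle term of the expansion below is [2 al e], which is [- c] since [e * e = 1];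
   [al] is real because [e] and [c] are. *)
pose al := - (e * c / 2).
have alc : conjc al = al.
  by rewrite /al rmorphN !rmorphM fmorphV rmorph_nat /= ec cc.
exists (v + al *: (A ^+ j.+1 *m v)); split.
- by apply: in_orthD => //; apply/in_orthZ/in_orthX.
- by rewrite mulmxDr h2 -scalemxAr mulmx_expD addnC -mulmx_expD h2 mulmx0 scaler0 addr0.
move=> q hq.
have -> : hform (v + al *: (A ^+ j.+1 *m v)) (A ^+ q *m (v + al *: (A ^+ j.+1 *m v))) =
   hform v (A ^+ q *m v) + 2 * al * hform v (A ^+ (j.+1 + q) *m v)
   + al * al * hform v (A ^+ (j.+1 + j.+1 + q) *m v).
  rewrite mulmxDr -!scalemxAr !hformDl // !hformDr !hformZl // !hformZr alc.
  rewrite -!hform_adjX // !mulmx_expD.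
  by rewrite (addnC q) (addnA j.+1); ring.
rewrite (h3 (j.+1 + q)%N); last by lia.
rewrite (h3 (j.+1 + j.+1 + q)%N); last by lia.
case: (eqVneq q q0) => [-> | ne].
  rewrite -/c.
  have -> : (j.+1 + q0).+1 == k by rewrite /q0; lia.
  have -> : (j.+1 + j.+1 + q0).+1 == k = false by rewrite /q0; lia.
  have -> : q0.+1 == k = false by rewrite /q0; lia.
  rewrite mulr0 addr0 /al.
  have -> : 2 * - (e * c / 2) * e = - ((2 / 2) * (e * e) * c) by ring.
  by rewrite divff ?pnatr_eq0 // e2 !mul1r subrr.
rewrite h3; last by lia.
have -> : (j.+1 + q).+1 == k = false by lia.
have -> : (j.+1 + j.+1 + q).+1 == k = false by lia.
by rewrite !mulr0 !addr0.
Qed.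

Lemma chains_cons k e v : in_orth v -> A ^+ k *m v = 0 ->
  (forall q, hform v (A ^+ q *m v) = if q.+1 == k then e else 0) ->
  chains A ((k, e) :: L) (fun i => if i is i'.+1 then x i' else v).
Proof.
move=> hv kv hq; have [h1 h2 h3] := cA; split.
- move=> [|i] [|j] q //= hi hj.
  + by rewrite -hformC //; have [-> _] := hv j q hj; rewrite conjc0.
  + by rewrite hform_adjX //; have [-> _] := hv i q hi.
  + by rewrite h1.
- move=> [|i] [|j] q //= hi hj.
  + exact: hform_jconj_self.
  + by rewrite -hformC //; have [_ ->] := hv j q hj; rewrite conjc0.
  + rewrite -jconj_mul; last exact: omegaX.
    rewrite hform_jconjr // -hformC // hform_adjX //.
    by have [_ ->] := hv i q hi; rewrite conjc0 oppr0.
  + by rewrite h2.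
- by case=> [|i] //= hi; apply: h3.
Qed.

Lemma chains_extend d : H \in unitmx -> A ^+ d = 0 -> (total_size L < n)%N ->
  exists k e v, [/\ (0 < k)%N, e = 1 \/ e = -1 &
    chains A ((k, e) :: L) (fun i => if i is i'.+1 then x i' else v)].
Proof.
move=> uH Ad hs; have nP := P_neq0 hs.
(* The least exponent killing the complement is the length of the new chain; one power lower, the
   form is still nonzero there. *)
have ex : exists k, A ^+ k *m P == 0 by exists d; rewrite Ad mul0mx.
case: (ex_minnP ex) => -[|k] /eqP kP kmin; first by move: nP; rewrite -[P]mul1mx -kP eqxx.
have nHP : H *m A ^+ k *m P != 0.
  apply/eqP => e; suff /kmin : A ^+ k *m P == 0 by rewrite ltnn.
  by rewrite -[A ^+ k *m P](mulKmx uH) (mulmxA H) e mulmx0.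
have [a [b nab]] : exists a b : V, hform a (A ^+ k *m (P *m b)) != 0.
  have [i [j nij]] : exists i j, (H *m A ^+ k *m P) i j != 0.
    suff /existsP[i /existsP[j h]] : [exists i, exists j, (H *m A ^+ k *m P) i j != 0].
      by exists i, j.
    apply: contraR nHP => /existsPn h; apply/eqP/matrixP => i j; rewrite [RHS]mxE.
    by have /existsPn/(_ j) := h i; rewrite negbK => /eqP.
  exists (delta_mx i 0), (delta_mx j 0); rewrite /hform.
  rewrite (_ : _ *m _ = cadjmx (delta_mx i 0) *m (H *m A ^+ k *m P) *m delta_mx j 0);
    last by rewrite !mulmxA.
  rewrite (_ : cadjmx (delta_mx i 0) = delta_mx 0 i); last first.
    by apply/matrixP => p q; rewrite !mxE conjc_nat andbC.
  by rewrite -rowE -colE mxE [row _ _ _ _]mxE.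
have oPb := P_in_orth b; have oPa := P_in_orth a.
(* The second argument lies in the complement, so [a] can be projected as well without changing the
   value. *)
rewrite -hform_P in nab; last exact: in_orthX.
have [c [f nx]] := polarize nab.
set u := (_ + _) in nx.
have ou : in_orth u by apply: in_orthD; apply: in_orthZ.
have ku : A ^+ k.+1 *m u = 0.
  by rewrite /u mulmxDr -!scalemxAr !(mulmxA _ P) kP !mul0mx !scaler0 addr0.
have [|t [tc ht]] := real_unit_scale _ nx; first by rewrite hformC // -hform_adjX.
have := @normalize k.+1 _ (t *: u) isT ht (in_orthZ t ou) _ _.
case=> [||v [h1 h2 h3]].
- by rewrite -scalemxAr ku scaler0.
- by rewrite -scalemxAr hformZr hformZl // tc mulrA.
exists k.+1, (t * t * hform u (A ^+ k *m u)), v; split => //.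
exact: chains_cons.
Qed.

End Growth.

(** Induction on [n - total_size L], starting from the empty system; each extension adds a block of
    positive size. *)
Lemma nilpotent_chains A d : H \in unitmx -> inOmega A -> H_selfadjoint H A -> A ^+ d = 0 ->
  exists L x, [/\ all (fun c => 0 < c.1)%N L, signs L, total_size L = n & chains A L x].
Proof.
move=> uH OA sA Ad.
suff key N : forall L x, all (fun c => 0 < c.1)%N L -> signs L -> chains A L x ->
    (n - total_size L <= N)%N ->
    exists L x, [/\ all (fun c => 0 < c.1)%N L, signs L, total_size L = n & chains A L x].
  by apply: (key n [::] (fun _ => 0)) => //; rewrite leq_subr.
elim: N => [|N IH] L x pL sL cL hN.
  by exists L, x; split => //; have := total_size_chains OA sA cL sL; lia.
case: (ltnP (total_size L) n) => hs; last first.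
  by exists L, x; split => //; have := total_size_chains OA sA cL sL; lia.
have [k [e [v [k0 he cv]]]] := chains_extend OA sA cL sL uH Ad hs.
apply: (IH _ _ _ _ cv) => /=.
- by rewrite k0.
- by case=> [|i] //= hi; apply: sL.
- by move: hN; rewrite /total_size /=; lia.
Qed.

(** * Chains of powers and of roots *)

Section Mix.
Variables (m r : nat).
Hypothesis hr : (0 < r <= m)%N.
Local Notation mt := (mate m r).
Local Notation mix_self := (mix_self R m r).
Local Notation mix_mate := (mix_mate R m r).

Definition mix (u : nat -> V) i : V := mix_self i *: u i + mix_mate i *: u (mt i).

Lemma hform_mix B u v i i' : hform (mix u i) (B *m mix v i') =
  mixg m r (fun i i' => hform (u i) (B *m v i')) i i'.
Proof.
rewrite /mix mulmxDr -!scalemxAr hformDl // !hformZl // mix_self_conj mix_mate_conj !hformDr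
    !hformZr.
by rewrite /mixg !mulrDr !mulrA.
Qed.

Lemma jconj_mix u i : jconj (mix u i) = mix (fun i => jconj (u i)) i.
Proof.
rewrite /jconj /mix cconjmxD mulmxDr !cconjmxZ -!scalemxAr.
by rewrite mix_self_conj mix_mate_conj.
Qed.

End Mix.

(** Chains with two indices: [j] numbers the chains of the root and [i] the residue classes modulo
    [m]. Position [j m + i] in [blocks_B] is the flat index. *)
Definition dchains B m t (k : nat -> nat -> nat) (e : nat -> nat -> C)
    (y : nat -> nat -> V) : Prop :=
  [/\ forall j i j' i' q, (j < t)%N -> (i < m)%N -> (j' < t)%N -> (i' < m)%N ->
        hform (y j i) (B ^+ q *m y j' i') =
        if (j == j') && ((i == i') && (q.+1 == k j i)) then e j i else 0,
      forall j i j' i' q, (j < t)%N -> (i < m)%N -> (j' < t)%N -> (i' < m)%N ->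
        hform (y j i) (B ^+ q *m jconj (y j' i')) = 0
    & forall j i, (j < t)%N -> (i < m)%N -> B ^+ k j i *m y j i = 0].

Lemma dchains_chains B m t a r eps y : (0 < m)%N ->
  dchains B m t (fun j => power_size (a j) (r j)) eps y ->
  chains B (blocks_B m t a r eps) (fun p => y (p %/ m)%N (p %% m)%N).
Proof.
move=> m0 [h1 h2 h3].
have hb p : (p < size (blocks_B m t a r eps))%N -> [/\ (p %/ m < t)%N, (p %% m < m)%N &
    nth (0%N, 0) (blocks_B m t a r eps) p =
    (power_size (a (p %/ m)%N) (r (p %/ m)%N) (p %% m)%N, eps (p %/ m)%N (p %% m)%N)].
  rewrite size_blocks => hp; rewrite ltn_divLR // hp ltn_pmod //; split => //.
  by rewrite [in LHS](divn_eq p m) nth_blocks ?ltn_divLR ?ltn_pmod.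
split.
- move=> p p' q /hb[hj hi e] /hb[hj' hi' _]; rewrite h1 // /block_size /block_sign e andbA.
  congr (if _ && _ then _ else _); apply/andP/eqP => [[/eqP e1 /eqP e2] | -> //].
  by rewrite (divn_eq p m) (divn_eq p' m) e1 e2.
- by move=> p p' q /hb[hj hi e] /hb[hj' hi' _]; rewrite h2.
- by move=> p /hb[hj hi e]; rewrite /block_size e h3.
Qed.

Lemma chains_dchains B m t a r eps y : (0 < m)%N ->
  chains B (blocks_B m t a r eps) y ->
  dchains B m t (fun j => power_size (a j) (r j)) eps (fun j i => y (j * m + i)%N).
Proof.
move=> m0 [h1 h2 h3].
have hb j i : (j < t)%N -> (i < m)%N -> (j * m + i < size (blocks_B m t a r eps))%N.
  move=> hj hi; rewrite size_blocks.
  by rewrite (@leq_trans (j.+1 * m)) ?leq_mul2r ?hj ?orbT // mulSn; lia.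
split.
- move=> j i j' i' q hj hi hj' hi'; rewrite h1 ?hb // /block_size /block_sign nth_blocks // andbA.
  congr (if _ && _ then _ else _); apply/eqP/andP => [e | [/eqP -> /eqP ->] //].
  have := congr1 (modn^~ m) e; rewrite !modnMDl !modn_small // => ->; split=> //.
  by have := congr1 (divn^~ m) e; rewrite !divnMDl // !divn_small // !addn0 => ->.
- by move=> j i j' i' q hj hi hj' hi'; rewrite h2 ?hb.
- by move=> j i hj hi; have := h3 _ (hb _ _ hj hi); rewrite /block_size nth_blocks.
Qed.

Lemma mixX B q m r (u : nat -> V) i : B ^+ q *m mix m r u i = mix m r (fun i => B ^+ q *m u i) i.
Proof. by rewrite /mix mulmxDr -!scalemxAr. Qed.

Lemma mix0 m r (u : nat -> V) i : u i = 0 -> u (mate m r i) = 0 -> mix m r u i = 0.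
Proof. by rewrite /mix => -> ->; rewrite !scaler0 addr0. Qed.

(* Taking the [m]-th power of a chain of length [a m + r] splits it into [m]
   chains, on which the form pairs the residue classes [i] and [mate i]. *)
Lemma chains_power A L x m (a r : nat -> nat) : (0 < m)%N -> inOmega A -> H_selfadjoint H A ->
  (forall j, (j < size L)%N -> (0 < r j <= m)%N /\ block_size L j = (a j * m + r j)%N) ->
  chains A L x ->
  dchains (A ^+ m) m (size L) (fun j => power_size (a j) (r j)) (std_sign m r (block_sign L))
    (fun j i => mix m (r j) (fun i => A ^+ i *m x j) i).
Proof.
move=> m0 OA sA hL [h1 h2 h3].
have hX q : (A ^+ m) ^+ q = A ^+ (q * m) by rewrite mulnC exprM.
split.
- move=> j i j' i' q hj hi hj' hi'; have [hr eK] := hL j hj; have [hr' _] := hL j' hj'.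
  rewrite hX mixX.
  case: (eqVneq j j') => [ej | nj].
    subst j'; rewrite -mixX hform_mix /=.
    pose t i := if q.+1 == power_size (a j) (r j) i then block_sign L j else 0.
    rewrite (mixg_ext hr (g' := fun i i' => if i' == mate m (r j) i then t i else 0)) //.
      rewrite (mixg_swap hr) // /t ?power_size_mate //; case: eqP => //= _.
      by rewrite /std_sign; case: ifP => // _; rewrite mulr0.
    move=> l l' hl hl'; rewrite mulmx_expD -hform_adjX // mulmx_expD h1 // eqxx /= eK
        mate_arith //.
    by rewrite /t; case: eqP.
  rewrite -mixX /= {1}/mix hformDl // !hformZl // !mix_self_conj !mix_mate_conj !mixX.
  have z l : hform (A ^+ l *m x j) (mix m (r j') (fun i =>
      A ^+ (q * m) *m (A ^+ i *m x j')) i') = 0.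
    rewrite /mix hformDr !hformZr !mulmx_expD -!hform_adjX // !mulmx_expD !h1 // (negbTE nj) /=.
    by rewrite !mulr0 addr0.
  by rewrite !z !mulr0 addr0.
- move=> j i j' i' q hj hi hj' hi'; rewrite hX jconj_mix mixX.
  rewrite {1}/mix hformDl // !hformZl //.
  have z l : hform (A ^+ l *m x j)
      (mix m (r j') (fun i => A ^+ (q * m) *m jconj (A ^+ i *m x j')) i') = 0.
    rewrite /mix hformDr !hformZr !jconj_mul; try exact: omegaX.
    by rewrite !mulmx_expD -!hform_adjX // !mulmx_expD !h2 // !mulr0 addr0.
  by rewrite !z !mulr0 addr0.
- move=> j i hj hi; have [hr eK] := hL j hj; rewrite hX mixX.
  have z l : (l < m)%N -> A ^+ (power_size (a j) (r j) l * m) *m (A ^+ l *m x j) = 0.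
    move=> hl; rewrite mulmx_expD.
    have hle : (block_size L j <= power_size (a j) (r j) l * m + l)%N.
      rewrite eK /power_size; case: ifP => h; rewrite ?mulSn; lia.
    by rewrite -(subnK hle) -mulmx_expD h3 // mulmx0.
  by apply: mix0; [exact: z | rewrite -(power_size_mate _ hr hi); apply/z/mate_lt].
Qed.

Lemma Jmx_omega L : total_size L = n -> inOmega (Jmx (L ++ L) (n + n)).
Proof.
move=> e; exists (Jmx L n), 0.
by rewrite (Jmx_cat e e) Jmx_conj /cconjmx map_mx0 oppr0.
Qed.

(** Checked in the basis [S], where it becomes the symmetry [QmxJmx_sym]. *)
Lemma selfadjoint_of_chain L A (S : 'M[C]_(n + n)) : total_size L = n -> S \in unitmx ->
  cadjmx S *m H *m S = Qmx (L ++ L) (n + n) -> A *m S = S *m Jmx (L ++ L) (n + n) ->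
  H_selfadjoint H A.
Proof.
move=> e uS eQ eJ; rewrite /H_selfadjoint.
have uS' := cadjmx_unit uS.
apply: (can_inj (mulKmx uS')); apply: (can_inj (mulmxK uS)).
rewrite -!(mulmxA (cadjmx S)) -(mulmxA H) eJ !mulmxA eQ -cadjmxM eJ cadjmxM.
rewrite -!mulmxA (mulmxA _ H) eQ.
rewrite /cadjmx Jmx_conj -{1}QmxJmx_sym ?trmx_mul ?Qmx_tr //.
by rewrite total_size_cat e.
Qed.

(* Conversely, undoing the mixing and interleaving the [m] chains gives chains
   [w j] of length [a m + r] of an operator [A] with [A^m = B]. *)
Lemma dchains_root B m t a r (eta : nat -> C) y : (0 < m)%N ->
  inOmega B -> H_selfadjoint H B ->
  (forall j, (j < t)%N -> (0 < r j <= m)%N) ->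
  (forall j, (j < t)%N -> eta j = 1 \/ eta j = -1) ->
  sumn [seq (a j * m + r j)%N | j <- iota 0 t] = n ->
  dchains B m t (fun j => power_size (a j) (r j)) (std_sign m r eta) y ->
  exists A, [/\ inOmega A, H_selfadjoint H A & A ^+ m = B].
Proof.
move=> m0 OB sB hr heta hn [h1 h2 h3].
(* Mixing undoes the diagonalization: the classes [i] and [mate m (r j) i] are now paired like
   powers of an operator applied to one vector. *)
pose u j := mix m (r j) (y j).
pose K j := (a j * m + r j)%N.
pose L := [seq (K j, eta j) | j <- iota 0 t].
have sL : size L = t by rewrite size_map size_iota.
have nL j : (j < t)%N -> nth (0%N, 0) L j = (K j, eta j).
  by move=> hj; rewrite (nth_map 0%N) ?size_iota // nth_iota.
have bL j : (j < t)%N -> block_size L j = K j by move=> hj; rewrite /block_size nL.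
have eL j : (j < t)%N -> block_sign L j = eta j by move=> hj; rewrite /block_sign nL.
have zL : total_size L = n by rewrite /total_size /unzip1 -map_comp -hn; congr sumn;
    apply: eq_map.
have gL : signs L by move=> j; rewrite sL => hj; rewrite eL //; apply: heta.
have u1 j i j' i' q : (j < t)%N -> (i < m)%N -> (j' < t)%N -> (i' < m)%N ->
    hform (u j i) (B ^+ q *m u j' i') =
    if (j == j') && ((i + (q * m + i')).+1 == K j)%N then eta j else 0.
  move=> hj hi hj' hi'; rewrite /u.
  case: (eqVneq j j') => [ej | nj].
    subst j'; rewrite hform_mix /=.
    pose T i := if q.+1 == power_size (a j) (r j) i then eta j else 0.
    rewrite (mixg_ext (hr _ hj)
      (g' := fun i i' => if i == i' then mate_sign R m (r j) i * T i else 0)) //.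
      rewrite (mixg_diag (hr _ hj)) // /T ?power_size_mate ?hr // mate_arith ?hr //.
      by case: eqP.
    move=> l l' hl hl'; rewrite h1 // eqxx /= /T /std_sign; case: eqP => //= _.
    by case: ifP => // _; rewrite mulr0.
  rewrite mixX {1}/mix hformDl // !hformZl //.
  have z l : (l < m)%N -> hform (y j l) (mix m (r j') (fun i => B ^+ q *m y j' i) i') = 0.
    by move=> hl; rewrite /mix hformDr !hformZr !h1 ?mate_lt ?hr // (negbTE nj) /= !mulr0 addr0.
  by rewrite !z ?mate_lt ?hr // !mulr0 addr0.
have u2 j i j' i' q : (j < t)%N -> (i < m)%N -> (j' < t)%N -> (i' < m)%N ->
    hform (u j i) (B ^+ q *m jconj (u j' i')) = 0.
  move=> hj hi hj' hi'; rewrite /u jconj_mix mixX {1}/mix hformDl // !hformZl //.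
  have z l : (l < m)%N -> hform (y j l) (mix m (r j') (fun i => B ^+ q *m jconj (y j' i)) i') = 0.
    by move=> hl; rewrite /mix hformDr !hformZr !h2 ?mate_lt ?hr // !mulr0 addr0.
  by rewrite !z ?mate_lt ?hr // !mulr0 addr0.
have u3 j i : (j < t)%N -> (i < m)%N -> B ^+ power_size (a j) (r j) i *m u j i = 0.
  move=> hj hi; rewrite /u mixX; apply: mix0; first exact: h3.
  by rewrite -(power_size_mate _ (hr _ hj) hi) h3 // mate_lt // hr.
(* [w j l] plays the role of [A^l x] for the generator [x] of the [j]-th chain of the root: dividing
   [l] by [m] gives the power of [B] and the class. *)
pose w j l := B ^+ (l %/ m) *m u j (l %% m)%N.
have w0 j l : (j < t)%N -> (K j <= l)%N -> w j l = 0.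
  move=> hj hl; rewrite /w; have hi : (l %% m < m)%N by rewrite ltn_pmod.
  suff hle : (power_size (a j) (r j) (l %% m) <= l %/ m)%N.
    by rewrite -(subnK hle) -mulmx_expD u3 // mulmx0.
  move: hl; rewrite {1}(divn_eq l m) /K /power_size; have := hr j hj => hrj.
  case: ifP => h hl; rewrite leqNgt; apply/negP => h'.
    have : (l %/ m * m <= a j * m)%N by rewrite leq_mul2r; apply/orP; right; lia.
    by lia.
  have : ((l %/ m).+1 * m <= a j * m)%N by rewrite leq_mul2r h' orbT.
  by rewrite mulSn; lia.
have wB j l : B *m w j l = w j (l + m)%N.
  by rewrite /w -{1}(expr1 B) mulmx_expD modnDr divnDr // divnn m0 addn1 add1n.
have w1 j l j' l' : (j < t)%N -> (j' < t)%N ->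
    hform (w j l) (w j' l') = if (j == j') && ((l + l').+1 == K j) then eta j else 0.
  move=> hj hj'; rewrite /w -hform_adjX // mulmx_expD u1 ?ltn_pmod // mulnDl.
  congr (if _ && (_.+1 == _) then _ else _).
  by rewrite {3}(divn_eq l m) {3}(divn_eq l' m); lia.
have w2 j l j' l' : (j < t)%N -> (j' < t)%N -> hform (w j l) (jconj (w j' l')) = 0.
  move=> hj hj'; rewrite /w jconj_mul; last exact: omegaX.
  by rewrite -hform_adjX // mulmx_expD u2 ?ltn_pmod.
clearbody w.
pose f j l := w j (K j - l.+1)%N.
pose X := fam_mx L f n.
have hloc (p : 'I_n) : ((loc (unzip1 L) p).1 < t)%N /\
    ((loc (unzip1 L) p).2 < K (loc (unzip1 L) p).1)%N.
  have hp : (p < total_size L)%N by rewrite zL.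
  by have [] := loc_block_size hp; rewrite sL => hi; rewrite bL.
have fX : frame L X.
  split; last first.
    rewrite /X jconj_fam gram_fam; apply/matrixP => p q; rewrite !mxE.
    by have [hi _] := hloc p; have [hj _] := hloc q; rewrite /f w2.
  rewrite /X gram_fam; apply/matrixP => p q; rewrite !mxE /Qent.
  have [hi hl] := hloc p; have [hj hl'] := hloc q.
  rewrite /f w1 // nL //=; case: eqP => //= e; rewrite -e in hl' *.
  by congr (if _ then _ else _); lia.
pose S := row_mx X (jconj X).
have uS : S \in unitmx := frame_unit zL gL fX.
have OS : inOmega S := jconj_omega X.
have GS : cadjmx S *m H *m S = Qmx (L ++ L) (n + n).
  by rewrite (frame_gram zL gL fX) (Qmx_cat zL zL).
have [A [AS OA]] : exists A, A *m S = S *m Jmx (L ++ L) (n + n) /\ inOmega A.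
  exists (S *m Jmx (L ++ L) (n + n) *m invmx S); rewrite mulmxKV //; split => //.
  by apply: omegaM; [apply/omegaM/Jmx_omega | apply: omegaV].
exists A; split => //; first exact: (selfadjoint_of_chain zL uS GS AS).
have AX : A *m X = X *m Jmx L n.
  move: AS; rewrite /S (Jmx_cat zL zL) mul_mx_row mul_row_block !mulmx0 addr0 add0r.
  by case/eq_row_mx.
(* For [l < K j] this is the column of [A X = X J] at offset [K j - l - 1]; at offset 0 the column
   is zero, and so is [w j (K j)]. *)
have wA j l : (j < t)%N -> A *m w j l = w j l.+1.
  move=> hj; case: (leqP (K j) l) => hl; first by rewrite !w0 ?mulmx0 // leqW.
  have hj' : (j < size L)%N by rewrite sL.
  have hl' : (K j - l.+1 < block_size L j)%N by rewrite bL //; lia.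
  have [hp elp] := loc_start_block hj' hl'; rewrite zL in hp; pose p := Ordinal hp.
  apply/matrixP => b z; rewrite ord1 {z}.
  have /matrixP/(_ b p) := AX; rewrite /X mul_fam mulmx_Jmx // [LHS]mxE elp /=.
  rewrite {1}/f (_ : K j - (K j - l.+1).+1 = l)%N; last by lia.
  move=> ->; case: ifP => h; last by rewrite w0 ?mxE //; lia.
  have hps : (p < total_size L)%N by rewrite zL.
  have [|p0 hq] := @loc_pred _ p hps; first by rewrite elp.
  have hv : insubd p (p : nat).-1 = p.-1 :> nat.
    by rewrite val_insubd ifT // (leq_ltn_trans (leq_pred _)).
  move: (insubd _ _) hv => p' hv.
  rewrite [LHS]mxE hv hq elp /f; congr (w _ _ _ _) => /=; lia.
have wAX j l q : (j < t)%N -> A ^+ q *m w j l = w j (l + q)%N.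
  move=> hj; elim: q => [|q IH]; first by rewrite expr0 mul1mx addn0.
  by rewrite mulmx_expS IH wA // addnS.
apply: (can_inj (mulmxK uS)).
(* Both sides send [w j l] to [w j (l + m)]. Since [A^m] and [B] commute with [j], agreement extends
   to [jconj X]. *)
have eX : A ^+ m *m X = B *m X.
  rewrite /X !mul_fam; apply/matrixP => b p; rewrite mxE [RHS]mxE.
  by have [hj _] := hloc p; rewrite /f wAX // wB.
rewrite /S !mul_mx_row -!jconj_mul ?eX //.
exact: omegaX.
Qed.

End Form.

(** Over an algebraically closed field the characteristic polynomial splits, here into a power of
    [X], and Cayley-Hamilton applies. *)
Lemma nilpotent_of_spectrum (R : realType) N (B : 'M[R[i]]_N) :
  spectrum_is_zero B -> exists d, B ^+ d = 0.
Proof.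
case: N B => [|N] B hB; first by exists 1%N; rewrite [LHS]flatmx0 [RHS]flatmx0.
have [rs hrs] := closed_field_poly_normal (char_poly B).
rewrite (monicP (char_poly_monic B)) scale1r in hrs.
have r0 z : z \in rs -> z = 0.
  move=> hz; apply/hB; rewrite eigenvalue_root_char hrs root_prod_XsubC //.
have e : char_poly B = 'X^(size rs).
  rewrite hrs; elim: rs r0 {hrs} => [|z rs IH] r0 /=; first by rewrite big_nil.
  rewrite big_cons (r0 z) ?mem_head // subr0 IH ?exprS //.
  by move=> y hy; apply: r0; rewrite inE hy orbT.
exists (size rs); have := Cayley_Hamilton B; rewrite e.
by rewrite rmorphXn /= horner_mx_X.
Qed.

(** * From block forms in [Omega] back to chains *)

Section Halves.
Variables (R : realType) (n : nat).
Local Notation C := R[i].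
Variables H B : 'M[C]_(n + n).
Hypotheses (OH : inOmega H) (hH : is_hermitian H).
Hypotheses (OB : inOmega B) (sB : H_selfadjoint H B).
Local Notation V := 'cV[C]_(n + n).
Implicit Types L : seq (nat * C).

(* Membership in [Omega] forces a block boundary at [n] and makes the two halves
   of the block list coincide, since both are read off the same matrix. *)
Lemma omega_halves L (S : 'M[C]_(n + n)) : total_size L = (n + n)%N -> signs L ->
  all (fun c => 0 < c.1)%N L ->
  inOmega S -> S \in unitmx -> invmx S *m B *m S = Jmx L (n + n) ->
  cadjmx S *m H *m S = Qmx L (n + n) ->
  exists L1 (X : 'M[C]_(n + n, n)),
    [/\ L = L1 ++ L1, total_size L1 = n, frame H L1 X & B *m X = X *m Jmx L1 n].
Proof.
move=> zL gL pL OS uS eJ eQ.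
have OJ : inOmega (Jmx L (n + n)).
  by rewrite -eJ; apply: omegaM => //; apply: omegaM => //; apply: omegaV.
have OQ : inOmega (Qmx L (n + n)).
  by rewrite -eQ; apply: omegaM => //; apply: omegaM => //; apply: omega_adj.
have [A1 [A2 eA]] := OJ; have [Q1 [Q2 eQQ]] := OQ.
have [|N' eN hN|L1 [L2 [eL zL1]]] := @pos_split _ L n pL.
- by rewrite zL leq_addr.
- have hN' : (N' < n)%N by rewrite eN.
  have h0 : (0 < n)%N by rewrite eN.
  pose p := Ordinal hN'; pose z := Ordinal h0.
  (* The superdiagonal entry in column [n] is, up to sign and conjugation, the entry at row [n + p]
     and column 0, which lies below the diagonal and vanishes. *)
  have /matrixP/(_ (lshift n p) (rshift n z)) := eA.
  have /matrixP/(_ (rshift n p) (lshift n z)) := eA.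
  rewrite block_mxEdl block_mxEur !mxE /= /Jent addn0 andbF => /esym/eqP.
  by rewrite oppr_eq0 => /eqP -> ->; rewrite conjc0.
subst L; have zL2 : total_size L2 = n by move: zL; rewrite total_size_cat zL1; lia.
have gL1 : signs L1.
  move=> i hi; have := gL i; rewrite size_cat /block_sign nth_cat hi; apply; lia.
rewrite (Jmx_cat zL1 zL2) in eA; rewrite (Qmx_cat zL1 zL2) in eQQ.
have [ea _ _ eb] := eq_block_mx eA; have [ec _ _ ed] := eq_block_mx eQQ.
(* The diagonal blocks of a matrix in [Omega] are conjugates of each other, and [Jmx] and [Qmx] are
   real here, so both halves carry the same matrices. *)
have e12 : L1 = L2.
  move: pL; rewrite all_cat => /andP[p1 p2]; apply: pos_inj => //; first by rewrite zL1.
  rewrite zL1 => p q hp hq.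
  have eJ12 : Jmx L2 n = Jmx L1 n by rewrite eb -ea Jmx_conj.
  have eQ12 : Qmx L2 n = Qmx L1 n by rewrite ed -ec signs_conj.
  have /matrixP/(_ (Ordinal hp) (Ordinal hq)) := eJ12.
  have /matrixP/(_ (Ordinal hp) (Ordinal hq)) := eQ12.
  by rewrite !mxE.
subst L2; exists L1, (lsubmx S).
have BS : B *m S = S *m Jmx (L1 ++ L1) (n + n) by rewrite -eJ mulmxA mulKVmx.
have eS := omega_row OS; set X := lsubmx S in eS *.
rewrite eS (Jmx_cat zL1 zL1) mul_mx_row mul_row_block !mulmx0 addr0 add0r in BS.
rewrite eS (Qmx_cat zL1 zL1) cadjmx_row mul_col_mx mul_col_row in eQ.
have [q1 q2 _ _] := eq_block_mx eQ.
by split=> //; case/eq_row_mx: BS.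
Qed.

Lemma hform_col s (X Y : 'M[C]_(n + n, s)) p q :
  hform H (col p X) (col q Y) = (cadjmx X *m H *m Y) p q.
Proof.
rewrite /hform [LHS]mxE [RHS]mxE; apply: eq_bigr => j _.
rewrite [col _ _ _ _]mxE; congr (_ * _); rewrite [LHS]mxE [RHS]mxE.
by apply: eq_bigr => k _; rewrite !mxE.
Qed.

Lemma jconj_col s (X : 'M[C]_(n + n, s)) p : jconj (col p X) = col p (jconj X).
Proof.
rewrite /jconj !colE cconjmxM -mulmxA; congr (_ *m (_ *m _)).
by apply/matrixP => i j; rewrite !mxE conjc_nat.
Qed.

(** Converse of [chains_frame]: the last column of each block is a generator. *)
Lemma frame_chains L (X : 'M[C]_(n + n, n)) : all (fun c => 0 < c.1)%N L ->
  total_size L = n -> frame H L X -> B *m X = X *m Jmx L n -> exists y, chains H B L y.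
Proof.
move=> pL zL [f1 f2] eX.
pose g p : V := if insub p is Some p' then col p' X else 0.
have gE (p : 'I_n) : g p = col p X by rewrite /g valK.
have pos i : (i < size L)%N -> (0 < block_size L i)%N by move=> hi; move/all_nthP: pL; apply.
have gB i l : (i < size L)%N -> (l < block_size L i)%N ->
    B *m g (start (unzip1 L) i + l)%N = if l is l'.+1 then g (start (unzip1 L) i + l')%N else 0.
  move=> hi hl; have [hp el] := loc_start_block hi hl; rewrite zL in hp.
  rewrite -[X in g X]/(nat_of_ord (Ordinal hp)) gE colE mulmxA eX -colE.
  apply/matrixP => b z; rewrite ord1 mxE mulmx_Jmx //= el /=.
  case: l hl hp el => [|l] hl hp el /=; first by rewrite mxE.
  have hp' : (start (unzip1 L) i + l < n)%N by rewrite -ltnS -addnS ltnW.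
  rewrite -[X in g X]/(nat_of_ord (Ordinal hp')) gE mxE.
  by congr (X _ _); apply: val_inj; rewrite val_insubd /= addnS /= hp'.
have gX i l q : (i < size L)%N -> (l < block_size L i)%N ->
    B ^+ q *m g (start (unzip1 L) i + l)%N =
    if (q <= l)%N then g (start (unzip1 L) i + (l - q))%N else 0.
  move=> hi hl; elim: q => [|q IH]; first by rewrite expr0 mul1mx subn0.
  rewrite mulmx_expS IH; case: ifP => h.
    rewrite gB //; last by lia.
    case e : (l - q)%N => [|d]; first by rewrite ifF //; lia.
    by rewrite ifT; [congr (g (_ + _)%N); lia | lia].
  by rewrite mulmx0 ifF //; lia.
exists (fun i => g (start (unzip1 L) i + (block_size L i).-1)%N); split.
- move=> i j q hi hj; have ki := pos i hi; have kj := pos j hj.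
  rewrite gX //; last by lia.
  case: (leqP q (block_size L j).-1) => h; last first.
    by rewrite hform0r; case: eqP => //= e; rewrite e ifF //; lia.
  have li : ((block_size L i).-1 < block_size L i)%N by lia.
  have lj : ((block_size L j).-1 - q < block_size L j)%N by lia.
  have [hp elp] := loc_start_block hi li; have [hq elq] := loc_start_block hj lj;
      rewrite zL in hp hq.
  rewrite -[X in hform H (g X)]/(nat_of_ord (Ordinal hp)).
  rewrite -[X in hform H _ (g X)]/(nat_of_ord (Ordinal hq)).
  rewrite !gE hform_col f1 mxE /Qent /= elp elq /= -/(block_size L i).
  case: eqP => //= e; subst j; congr (if _ then _ else _); lia.
- move=> i j q hi hj; have ki := pos i hi; have kj := pos j hj.
  rewrite -jconj_mul; last exact: omegaX.
  rewrite gX //; last by lia.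
  case: (leqP q (block_size L j).-1) => h; last first.
    by rewrite /jconj /cconjmx map_mx0 mulmx0 hform0r.
  have li : ((block_size L i).-1 < block_size L i)%N by lia.
  have lj : ((block_size L j).-1 - q < block_size L j)%N by lia.
  have [hp elp] := loc_start_block hi li; have [hq elq] := loc_start_block hj lj;
      rewrite zL in hp hq.
  rewrite -[X in hform H (g X)]/(nat_of_ord (Ordinal hp)).
  rewrite -[X in jconj (g X)]/(nat_of_ord (Ordinal hq)).
  by rewrite !gE jconj_col hform_col f2 mxE.
- move=> i hi; have ki := pos i hi; rewrite gX //; last by lia.
  by rewrite ifF //; lia.
Qed.

(** Blocks of size 0 leave no trace in the matrices but occur in [blocks_B] when [a j = 0] and
    [r j < m]; they receive the generator 0. *)
Lemma chains_reindex L1 L2 y : chains H B L1 y ->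
  perm_eq L1 [seq c <- L2 | (0 < c.1)%N] -> exists y', chains H B L2 y'.
Proof.
move=> [h1 h2 h3]; rewrite perm_sym => /(perm_iotaP (0%N, 0))[Is pI eI].
pose I := [seq i <- iota 0 (size L2) | (0 < block_size L2 i)%N].
have eF : [seq c <- L2 | (0 < c.1)%N] = [seq nth (0%N, 0) L2 i | i <- I].
  by rewrite -{1}(mkseq_nth (0%N, 0) L2) /mkseq filter_map.
have sI : size Is = size I.
  by have := congr1 size eI; rewrite eF !size_map.
(* [s i] is the place in [L1] of block [i] of [L2], injective on the nonempty blocks. *)
pose s i := nth 0%N Is (index i I).
have inI i : (i < size L2)%N -> (0 < block_size L2 i)%N -> i \in I.
  by move=> hi hk; rewrite mem_filter mem_iota hk hi.
have uI : uniq Is by rewrite (perm_uniq pI) iota_uniq.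
have sP i : i \in I -> (s i < size L1)%N /\ nth (0%N, 0) L1 (s i) = nth (0%N, 0) L2 i.
  move=> hi; have hx : (index i I < size Is)%N by rewrite sI index_mem.
  split.
    by have := mem_nth 0%N hx; rewrite (perm_mem pI) mem_iota => /andP[].
  have := congr1 (fun l => nth (0%N, 0) l (index i I)) eI.
  rewrite eF (nth_map 0%N) -?sI // (nth_map 0%N) // nth_index //.
have sinj i j : i \in I -> j \in I -> (s i == s j) = (i == j).
  move=> hi hj; rewrite /s nth_uniq ?sI ?index_mem //.
  by apply/eqP/eqP => [|-> //]; apply: index_inj.
exists (fun i => if (0 < block_size L2 i)%N then y (s i) else 0); split.
- move=> i j q hi hj; case: ifP => ki; last first.
    by rewrite hform0l //; case: ifP => // /andP[_ /eqP e]; rewrite -e in ki.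
  case: ifP => kj; last first.
    rewrite mulmx0 hform0r; case: ifP => // /andP[/eqP e _]; by rewrite e kj in ki.
  have iI := inI i hi ki; have jI := inI j hj kj.
  have [si ei] := sP i iI; have [sj ej] := sP j jI.
  by rewrite h1 // sinj // /block_size /block_sign ei.
- move=> i j q hi hj; case: ifP => ki; last by rewrite hform0l.
  case: ifP => kj; last by rewrite /jconj /cconjmx map_mx0 !mulmx0 hform0r.
  have [si _] := sP i (inI i hi ki); have [sj _] := sP j (inI j hj kj).
  by rewrite h2.
- move=> i hi; case: ifP => ki; last by rewrite mulmx0.
  by have [si ei] := sP i (inI i hi ki); have := h3 _ si; rewrite /block_size ei.
Qed.

End Halves.

(** * Assembling the equivalence *)

Lemma castmx_Jmx0 (R : realType) (L : seq (nat * R[i])) N M (Cr : 'M[R[i]]_0)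
    (e : (N + 0)%N = M) : castmx (e, e) (block_mx (Jmx L N) 0 0 Cr) = Jmx L M.
Proof.
have e' : N = M by rewrite -e addn0.
case: M / e' e => e; apply/matrixP => p q; rewrite castmxE.
have c (x : 'I_N) : cast_ord (esym e) x = lshift 0 x by apply: val_inj.
by rewrite !c block_mxEul !mxE.
Qed.

Theorem mainTheorem10 (R : realType) (n m : nat) (H B : 'M[R[i]]_(n + n)) :
  (1 <= m)%N ->
  inOmega H -> H \in unitmx -> is_hermitian H ->
  inOmega B -> H_selfadjoint H B -> spectrum_is_zero B ->
  (exists A : 'M[R[i]]_(n + n), inOmega A /\ H_selfadjoint H A /\ A ^+ m = B)
  <-> (cond1 m B /\ cond2 m H B).
Proof.
move=> m0 OH uH hH OB sB spB; split; last first.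
  case=> _ [S [t [a [r [eps [OS [uS [hr [he [hb [L [pL [e [eJ eQ]]]]]]]]]]]]]].
  rewrite blkJ_cast in eJ; rewrite blkQ_cast in eQ.
  have /boolp.choice[eta heta] : forall j, exists eta : R[i], (j < t)%N ->
      (eta = 1 \/ eta = -1) /\ balanced eta [seq eps j i | i <- iota 0 (r j)] /\
      balanced eta [seq eps j i | i <- iota (r j) (m - r j)].
    move=> j; case: (ltnP j t) => hj; last by exists 1.
    by have [et het] := hb j hj; exists et.
  have pstd := blocks_std a hr he heta.
  set std := blocks_B _ _ _ _ (std_sign _ _ _) in pstd.
  (* Block boundaries can be read off the matrices only when the sizes are positive, so empty blocks
     are discarded. *)
  pose L' := [seq c <- L | (0 < c.1)%N].
  have pL' : perm_eq L' ([seq c <- std | (0 < c.1)%N] ++ [seq c <- std | (0 < c.1)%N]).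
    rewrite -filter_cat; apply: perm_filter; apply: (perm_trans pL); exact: perm_cat.
  have zL : total_size L' = (n + n)%N by rewrite total_size_filter -big_bsize_all.
  have gL : signs L'.
    move=> i hi; have : nth (0%N, 0) L' i \in L' by apply: mem_nth.
    rewrite /block_sign mem_filter => /andP[_]; rewrite (perm_mem pL) mem_cat orbb.
    case/flatten_mapP => j; rewrite mem_iota => hj /mapP[i'].
    by rewrite mem_iota => hi' ->; apply: he; lia.
  have aL : all (fun c => 0 < c.1)%N L' by apply: filter_all.
  rewrite -Jmx_filter in eJ; rewrite -Qmx_filter in eQ.
  have [L1 [X [eL zL1 fX eX]]] := omega_halves OH OB zL gL aL OS uS eJ eQ.
  have aL1 : all (fun c => 0 < c.1)%N L1 by move: aL; rewrite eL all_cat => /andP[].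
  have [y cy] := frame_chains OB aL1 zL1 fX eX.
  have p1 : perm_eq L1 [seq c <- std | (0 < c.1)%N] by apply: perm_halves; rewrite -eL.
  have [y' cy'] := chains_reindex hH cy p1.
  have heta1 j : (j < t)%N -> eta j = 1 \/ eta j = -1 by move=> hj; have [] := heta j hj.
  have hn : sumn [seq (a j * m + r j)%N | j <- iota 0 t] = n.
    rewrite -(total_size_blocks a (std_sign m r eta) hr) -/std -total_size_filter -zL1.
    by apply/esym/perm_sumn/perm_map.
  have [A [OA sA eA]] := dchains_root OH hH m0 OB sB hr heta1 hn (chains_dchains m0 cy').
  by exists A.
case=> A [OA [sA eA]].
have [d Bd] := nilpotent_of_spectrum spB.
have Ad : A ^+ (m * d) = 0 by rewrite exprM eA.
have [L [x [aL gL zL cA]]] := nilpotent_chains OH hH uH OA sA Ad.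
(* Dividing the size minus one by [m] makes the shifted remainder [r j] range over 1 to [m] instead
   of 0 to [m - 1]. *)
pose a j := ((block_size L j).-1 %/ m)%N; pose r j := ((block_size L j).-1 %% m).+1.
have hL j : (j < size L)%N -> (0 < r j <= m)%N /\ block_size L j = (a j * m + r j)%N.
  move=> hj; rewrite /r ltn_pmod //; split => //.
  have : (0 < block_size L j)%N by move/all_nthP: aL; apply.
  by rewrite addnS -divn_eq; lia.
have hr j : (j < size L)%N -> (0 < r j <= m)%N by case/hL.
have dB := chains_power hH m0 OA sA hL cA; rewrite eA in dB.
have cB := dchains_chains m0 dB.
pose eps := std_sign m r (block_sign L).
set Bl := blocks_B _ _ _ _ _ in cB.
have zB : total_size Bl = n.
  have uL : unzip1 L = [seq block_size L j | j <- iota 0 (size L)].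
    by rewrite -{1}(mkseq_nth (0%N, 0) L) /mkseq /unzip1 -map_comp.
  rewrite total_size_blocks // -zL /total_size uL; congr sumn.
  by apply/eq_in_map => j; rewrite mem_iota => hj; case: (hL j hj).
have he j i : (j < size L)%N -> (i < m)%N -> eps j i = 1 \/ eps j i = -1.
  move=> hj hi; rewrite /eps /std_sign; have [-> | ->] := mate_sign_pm m (r j) i (block_sign L j);
    case: (gL j hj) => ->; rewrite ?opprK; by [left | right].
have gB : signs Bl.
  move=> p hp; have : nth (0%N, 0) Bl p \in Bl by apply: mem_nth.
  case/flatten_mapP => j; rewrite mem_iota => hj /mapP[i'].
  by rewrite mem_iota /block_sign => hi' ->; apply: he; lia.
have [fX eX] := chains_frame OB sB zB cB.
set X := fam_mx _ _ _ in fX eX.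
pose S := row_mx X (jconj X).
have uS : S \in unitmx := frame_unit OH hH zB gB fX.
have OS : inOmega S := jconj_omega X.
have GS : cadjmx S *m H *m S = Qmx (Bl ++ Bl) (n + n).
  by rewrite (frame_gram OH hH zB gB fX) (Qmx_cat zB zB).
have BS : invmx S *m B *m S = Jmx (Bl ++ Bl) (n + n).
  by rewrite -mulmxA (frame_mul zB OB eX) mulKmx.
split.
  pose s := unzip1 [seq c <- Bl ++ Bl | (0 < c.1)%N].
  exists s; split.
    split; first by rewrite all_map; apply: filter_all.
    have uz : unzip1 (unsigned R s) = s.
      by rewrite /unsigned /unzip1 -map_comp map_id.
    have e : ((\sum_(i < size (unsigned R s)) bsize i) + 0 = n + n)%N.
      by rewrite addn0 big_bsize_all /total_size uz -/(total_size _) total_size_filter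
          total_size_cat zB.
    (* The Jordan blocks at 0 fill the whole space, so the part without eigenvalue 0 is the empty
       matrix. *)
    exists 0%N, 0, S, e; split; first by rewrite /eigenvalue [eigenspace _ _]flatmx0 eqxx.
    split => //; rewrite BS.
    have := blkJ_cast (L := unsigned R s) erefl; rewrite castmx_id => ->.
    rewrite castmx_Jmx0 -Jmx_filter; apply/matrixP => p q.
    by rewrite !mxE /Jent uz.
  (* One tuple per chain of [A]; its two copies come from the halves [X] and [jconj X] of the
     basis. *)
  exists [seq [seq power_size (a j) (r j) i | i <- iota 0 m] | j <- iota 0 (size L)]; split.
    by apply/allP => u /mapP[j _ ->]; rewrite size_map size_iota.
  split.
    apply/allP => u /mapP[j _ ->]; apply/allP => p /mapP[i _ ->].
    by apply/allP => q /mapP[i' _ ->]; rewrite /power_size; case: ifP; case: ifP; lia.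
  have -> : s = [seq k <- unzip1 (Bl ++ Bl) | (0 < k)%N] by rewrite /unzip1 filter_map.
  apply: perm_filter; rewrite /unzip1 map_cat flatten_cat /Bl /blocks_B map_flatten -map_comp.
  rewrite (eq_map (g := fun j => [seq power_size (a j) (r j) i | i <- iota 0 m])) //.
  by move=> j /=; rewrite -map_comp.
exists S, (size L), a, r, eps; split => //; split => //; split => //; split => //.
split.
  move=> j hj; exists (block_sign L j); split; first exact: gL.
  have [b1 b2] := std_sign_balanced (hr j hj) (pm_neq0 (gL j hj)).
  by split.
exists (Bl ++ Bl); split => //.
have e : (\sum_(i < size (Bl ++ Bl)) bsize i = n + n)%N.
  by rewrite big_bsize_all total_size_cat zB.
by exists e; rewrite blkJ_cast blkQ_cast.
Qed.
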